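(* Let $\mathbb{FT}$ be the Fibonacci tree and let $\mathcal{P}(\mathbb{FT})$ be its pascalization. The set of all ergodic central probability measures on the space of infinite paths of $\mathcal{P}(\mathbb{FT})$ coincides with the family of Markov measures $$\Sigma=\{\nu_{(t,\eta)} \;:\; t\in\partial\mathbb{FT},\ \eta\in[0,4/27]\},$$ where $\nu_{(t,\eta)}$ is the lift to $\mathcal{P}(\mathbb{FT})$ of the law of the random walk $S_{(t,\eta)}$ on $\mathbb{FT}$.
   Context: Fibonacci tree: $\mathbb{FT}$ is the rooted tree with vertices labelled by $1$ or $2$, defined inductively: the root $\emptyset$ has label $1$; a vertex of label $1$ has exactly one child, which has label $2$; a vertex of label $2$ has exactly two children, one of label $2$ and one of label $1$. Write $l(v)$ for the label of $v$ (which is also its number of children), $|v|$ for its distance to the root, and $a$ for the unique vertex at distance $1$ from $\emptyset$. Ends: an end of $\mathbb{FT}$ is an infinite path $t=(t_0=\emptyset,t_1,t_2,\dots)$ with $t_{i+1}$ a child of $t_i$; $\partial\mathbb{FT}$ is the set of ends. For a vertex $v$, the geodesic ray from $v$ to $t$ is the path from $v$ towards the root up to the first vertex $t_m$ of $t$, continued by $t_{m+1},t_{m+2},\dots$. An ordered pair $(v,w)$ of neighbours is $t$-directed if $w$ lies on the geodesic ray from $v$ to $t$. Pascalization: for a rooted graph with levels $V_0=\{\emptyset\},V_1,\dots$ (edges joining only adjacent levels), the pascalization has level-$n$ vertices $(n,v)$ with $v\in V_k$, $k\le n$, $k\equiv n \bmod 2$, and the number of edges between $(n,v)$ and $(n+1,w)$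 is the number of edges between $v$ and $w$ in the original graph. Infinite paths $((n,w_n))_{n\ge0}$ in the pascalization starting at $(0,\emptyset)$ correspond bijectively to infinite walks $(w_n)_{n\ge 0}$ started at the root of the original graph. Central and ergodic measures: let $\Omega$ be the space of infinite paths started at the root of the pascalized graph, with the $\sigma$-algebra inherited from the product $\sigma$-algebra. A probability measure $\nu$ on $\Omega$ is central if, for every $n$ and every vertex $v$ of level $n$, all finite paths from the root to $v$ have the same $\nu$-probability (of being the initial segment of the random path). It is ergodic if every measurable set invariant under the tail relation (two paths are tail equivalent if they differ in finitely many steps) has $\nu$-measure $0$ or $1$. The walks $S_{(t,\eta)}$: let $G(z)=\sum_{n\ge0}\frac{1}{3n+1}\binom{3n+1}{n}z^n$ (radius of convergence $4/27$, convergent also at $4/27$). For $t\in\partial\mathbb{FT}$ and $\eta\in[0,4/27]$, $S_{(t,\eta)}$ is the unique time-homogeneous nearest neighbour random walk on $\mathbb{FT}$ started at $\emptyset$ whose transition probabilities $p=p_{(t,\eta)}$ satisfy: (i) $p(\emptyset,a)=1$, $p(a,\emptyset)=\eta$; (ii) for neighbours $v,w$ such that the edge between them does not lie on $t$: $p(v,w)=G(\eta)^{-l(v)}$ if $(v,w)$ is $t$-directed, and $p(v,w)=\eta\,G(\eta)^{l(w)}$ otherwise; (iii) $p(v,w)p(w,v)=\eta$ for all neighbours $v,w$. The measure $\nu_{(t,\eta)}$ is the Markov measure on infinite paths of $\mathcal{P}(\mathbb{FT})$ with transition probabilities $p_{\nu_{(t,\eta)}}((n,v),(n+1,w))=p_{(t,\eta)}(v,w)$.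 *)

(* Defs.v *)
From HB Require Import structures.
From mathcomp Require Import all_boot all_order all_algebra.
From mathcomp Require Import all_classical all_reals all_analysis.

Set Implicit Arguments.
Unset Strict Implicit.
Unset Printing Implicit Defensive.

Import Order.TTheory GRing.Theory Num.Theory.
Import numFieldNormedType.Exports.

Local Open Scope classical_set_scope.
Local Open Scope ring_scope.

Definition child_labels (l : nat) : seq nat :=
  if l == 1%N then [:: 2%N] else [:: 2%N; 1%N].

(* The children of a vertex have distinct labels, so a vertex is encoded by
   the labels met on the way from it to the root, the label 1 of the root
   itself being left out. *)
Fixpoint fib_word (s : seq nat) : bool :=
  if s is l :: s' then (l \in child_labels (head 1%N s')) && fib_word s'
  else true.

Record FT := Vertex { word : seq nat; word_ok : fib_word word }.

HB.instance Definition _ := [isSub for word].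
HB.instance Definition _ := [Countable of FT by <:].

Definition ft_root : FT := @Vertex [::] isT.
Definition vertex_a : FT := @Vertex [:: 2%N] isT.

Definition ft_label (v : FT) : nat := head 1%N (word v).
Definition ft_depth (v : FT) : nat := size (word v).

Lemma fib_word_behead (s : seq nat) : fib_word s -> fib_word (behead s).
Proof. by case: s => //= l s /andP[]. Qed.

(* [ft_parent ft_root = ft_root] is a junk value. *)
Definition ft_parent (v : FT) : FT := Vertex (fib_word_behead (word_ok v)).

Definition is_child (w v : FT) : bool := (w != ft_root) && (ft_parent w == v).

Definition ft_adj (v w : FT) : bool := is_child w v || is_child v w.

Record FTend := FTEnd {
  end_ray :> nat -> FT;
  end_ray0 : end_ray 0%N = ft_root;
  end_rayS : forall i, is_child (end_ray i.+1) (end_ray i) }.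

(* As [t i] has depth [i], [v] lies on [t] iff [v = t (ft_depth v)]. *)
Definition ray_next (t : FTend) (v : FT) : FT :=
  if v == t (ft_depth v) then t (ft_depth v).+1 else ft_parent v.

Definition geodesic_ray (t : FTend) (v : FT) (k : nat) : FT :=
  iter k (ray_next t) v.

Definition t_directed (t : FTend) (v w : FT) : Prop :=
  ft_adj v w /\ exists k, geodesic_ray t v k = w.

Definition edge_on (t : FTend) (v w : FT) : Prop :=
  exists i, (v = t i /\ w = t i.+1) \/ (v = t i.+1 /\ w = t i).

Record PFT := PVertex {
  pval : nat * FT;
  pval_ok : (ft_depth pval.2 <= pval.1)%N && (pval.1 == ft_depth pval.2 %[mod 2]) }.

HB.instance Definition _ := [isSub for pval].
HB.instance Definition _ := [Countable of PFT by <:].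

Definition plevel (x : PFT) : nat := (pval x).1.
Definition pbase (x : PFT) : FT := (pval x).2.

Definition proot : PFT := @PVertex (0%N, ft_root) isT.

(* The tree has no multiple edges, hence neither has its pascalization; edges
   are directed towards increasing levels. *)
Definition padj (x y : PFT) : bool :=
  (plevel y == (plevel x).+1) && ft_adj (pbase x) (pbase y).

Record ppath := PPath {
  pvert :> nat -> PFT;
  pvert0 : pvert 0%N = proot;
  pvertS : forall n, padj (pvert n) (pvert n.+1) }.

HB.instance Definition _ := gen_eqMixin ppath.
HB.instance Definition _ := gen_choiceMixin ppath.

Definition zigzag_base (n : nat) : FT := if odd n then vertex_a else ft_root.

Lemma zigzag_ok (n : nat) :
  (ft_depth (zigzag_base n) <= n)%N && (n == ft_depth (zigzag_base n) %[mod 2]).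
Proof.
rewrite /zigzag_base; case: ifPn => [on|on].
  by case: n on => // n on; rewrite ltnS leq0n /= !modn2 on.
by rewrite leq0n /= !modn2 (negbTE on).
Qed.

Definition zigzag (n : nat) : PFT := @PVertex (n, zigzag_base n) (zigzag_ok n).

Lemma zigzag0 : zigzag 0%N = proot.
Proof. exact: val_inj. Qed.

Lemma zigzagS (n : nat) : padj (zigzag n) (zigzag n.+1).
Proof.
by rewrite /padj /plevel /pbase /= eqxx /= /zigzag_base /=; case: (odd n).
Qed.

(* A measurable type has to be pointed; the point chosen here is the path that
   oscillates between the root and its child. *)
HB.instance Definition _ := isPointed.Build ppath (PPath zigzag0 zigzagS).

(* The vertex set is discrete, so the trace of the product sigma-algebra is
   generated by all conditions on a single coordinate. *)
Definition coord_events : set (set ppath) :=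
  [set A | exists (n : nat) (B : set PFT), A = [set w : ppath | B (w n)]].

Definition Omega := g_sigma_algebraType coord_events.

(* [s] lists the vertices of a finite path from the root, the root excepted. *)
Definition cylinder (s : seq PFT) : set Omega :=
  [set w | mkseq (fun i => (w : ppath) i.+1) (size s) = s].

Definition central (R : realType) (nu : probability Omega R) : Prop :=
  forall (v : PFT) (s s' : seq PFT),
    path padj proot s -> last proot s = v ->
    path padj proot s' -> last proot s' = v ->
    nu (cylinder s) = nu (cylinder s').

Definition path_step (w : ppath) (n : nat) : PFT * PFT := (w n, w n.+1).

Definition tail_equiv (w w' : ppath) : Prop :=
  finite_set [set n | path_step w n <> path_step w' n].

Definition tail_invariant (A : set Omega) : Prop :=
  forall w w' : Omega, tail_equiv w w' -> A w -> A w'.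

Definition ergodic (R : realType) (nu : probability Omega R) : Prop :=
  forall A : set Omega, measurable A -> tail_invariant A ->
    nu A = 0%E \/ nu A = 1%E.

Definition gen_G (R : realType) (z : R) : R :=
  limn (series (fun n : nat =>
    (3 * n + 1)%:R^-1 * 'C(3 * n + 1, n)%:R * z ^+ n : R)).

Definition nearest_neighbour_kernel (R : realType) (p : FT -> FT -> R) : Prop :=
  [/\ forall v w, 0 <= p v w,
      forall v w, ~~ ft_adj v w -> p v w = 0 &
      forall v, (\esum_(w in [set: FT]) (p v w)%:E = 1)%E].

Definition is_S_kernel (R : realType) (t : FTend) (eta : R)
    (p : FT -> FT -> R) : Prop :=
  nearest_neighbour_kernel p /\
  [/\ p ft_root vertex_a = 1 /\ p vertex_a ft_root = eta,
      forall v w, ft_adj v w -> ~ edge_on t v w ->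
        (t_directed t v w -> p v w = gen_G eta ^- ft_label v) /\
        (~ t_directed t v w -> p v w = eta * gen_G eta ^+ ft_label w) &
      forall v w, ft_adj v w -> p v w * p w v = eta].

(* Definite description: for [0 <= eta <= 4 / 27] there is exactly one such
   kernel. *)
Definition S_kernel (R : realType) (t : FTend) (eta : R) : FT -> FT -> R :=
  get [set p | is_S_kernel t eta p].

Definition pascal_kernel (R : realType) (p : FT -> FT -> R) (x y : PFT) : R :=
  if plevel y == (plevel x).+1 then p (pbase x) (pbase y) else 0.

Definition markov_measure (R : realType) (P : PFT -> PFT -> R)
    (nu : probability Omega R) : Prop :=
  forall s : seq PFT, path padj proot s ->
    nu (cylinder s) = (\prod_(xy <- zip (proot :: s) s) P xy.1 xy.2)%:E.

(* Definite description again: the Markov measure exists, and is unique on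
   measurable sets (a library measure also carries irrelevant values on the
   other sets). Were there no such measure, or no kernel as above, this would
   be the Dirac mass at the oscillating path, which is not central. *)
Definition nu_walk (R : realType) (t : FTend) (eta : R) : probability Omega R :=
  get [set nu : probability Omega R |
        markov_measure (pascal_kernel (S_kernel t eta)) nu].

Definition Sigma (R : realType) : set (probability Omega R) :=
  [set nu | exists (t : FTend) (eta : R), 0 <= eta <= 4 / 27 /\
    forall A : set Omega, measurable A -> nu A = nu_walk t eta A].

(* Main.v *)
Require Import Defs.
From HB Require Import structures.
From mathcomp Require Import all_boot all_order all_algebra.
From mathcomp Require Import all_classical all_reals all_analysis.
From mathcomp Require Import ring lra zify.

Set Implicit Arguments.
Unset Strict Implicit.
Unset Printing Implicit Defensive.

Import Order.TTheory GRing.Theory Num.Theory.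
Import numFieldNormedType.Exports.

Local Open Scope classical_set_scope.
Local Open Scope ring_scope.

(** A central measure is determined by the probability of any one path to each
    vertex of the pascalized tree, and a function on these vertices arises in
    this way exactly when it is nonnegative, equals 1 at the root, and is
    harmonic, its value at a vertex being the sum of its values at the next
    vertices ([harmonic_cyl_fun], [realization]). Under this correspondence the
    ergodic measures are the extremal harmonic functions ([ergodic_extremal],
    [extremal_ergodic]).

    Write a vertex of the pascalized tree as a pair of a vertex [v] of the tree
    and of half the excess [k] of the level over the depth of [v]. If [phi] is
    extremal then its shift by one in [k], which it dominates, is a multiple
    [eta] of it, so that [phi k v = eta ^+ k * h v], where [h] solves an
    eigenvalue equation on the tree ([eigen]). The infima of the ratios of [h]
    between a child and its parent satisfy two inequalities; they force
    [eta <= 4 / 27] and show that the ratio at a child [c] is at least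
    [eta * G ^+ ft_label c], with [G] the value of [gen_G] at [eta], which
    satisfies [G = 1 + eta * G ^+ 3] ([eigen_ratio], [eigen_gen_G_le]). The
    excess over this lower bound is, up to explicit weights, a flow on the
    tree, that is a measure on its ends, and [h] depends linearly on it
    ([eigen_defect]). Extremality therefore concentrates this measure at one
    end [t] ([extremal_off_ray]). Off [t] the lower bound is then attained, and
    together with the equation along [t] this determines [h]
    ([off_ray_eigen_unique]): it is the product of the transition probabilities
    of the walk of parameters [t] and [eta] along the geodesic from the root.

    Conversely, the harmonic function of this walk has the form
    [eta ^+ k * h v], with [h] attaining the lower bound off [t]. A harmonic
    function which it dominates need not have this form a priori, but a
    telescoping argument at an approximate maximum shows that it has
    ([dominated_shift]); the lower bound, applied to it and to its complement,
    is then attained off [t] for both, so that it is proportional to the given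
    function ([off_ray_extremal]).

    An ergodic [nu] is extremal because a central probability [mu] which is
    absolutely continuous with respect to [nu] equals [nu] ([ergodic_unique]):
    the two sets of a Hahn decomposition of [nu - mu] may be chosen tail
    invariant, because both measures are preserved by the exchange of two
    beginnings of paths with the same end point ([exchange_invariance]). *)

(** * The generating function of ternary trees *)

(** The coefficient of [z ^+ n] in the [r]-th power of the generating function
    [G] of ternary trees. The recursion says that
    [G ^+ r.+1 = G ^+ r + z * G ^+ (r + 3)], which is [G = 1 + z * G ^+ 3]
    multiplied by [G ^+ r]; here it is summed over the smaller exponents. *)
Fixpoint fuss (n r : nat) : nat :=
  if n is n'.+1 then (\sum_(j < r) fuss n' (j + 3))%N else 1%N.

Lemma fussS0 n : fuss n.+1 0 = 0%N.
Proof. by rewrite /= big_ord0. Qed.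

Lemma fussSS n r : fuss n.+1 r.+1 = (fuss n.+1 r + fuss n (r + 3))%N.
Proof. by rewrite /= big_ord_recr. Qed.

(** The closed form of the coefficients; the case [r = 1] is the one in
    [gen_G]. *)
Lemma fuss_bin n r : ((r + 3 * n) * fuss n r = r * 'C(r + 3 * n, n))%N.
Proof.
elim: n r => [|n IHn] r; first by rewrite muln0 addn0 bin0.
elim: r => [|r IHr]; first by rewrite fussS0 mul0n muln0.
have := IHn (r + 3)%N; rewrite fussSS.
set f1 := fuss n.+1 r in IHr *; set f2 := fuss n (r + 3).
rewrite (_ : r + 3 * n.+1 = r + 3 + 3 * n)%N in IHr; last by lia.
have -> : (r.+1 + 3 * n.+1 = (r + 3 + 3 * n).+1)%N by lia.
rewrite binS.
set m := (r + 3 + 3 * n)%N in IHr *.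
have := mul_bin_left m n.
have : (r + 3 + 3 * n)%N = m by [].
have mn : (n <= m)%N by rewrite /m; lia.
have : (m - n + n = m)%N by rewrite subnK.
move: (m - n)%N IHr; move: 'C(m, n.+1) 'C(m, n) => d c k.
have m0 : (0 < m)%N by rewrite /m; lia.
move: m m0 mn f1 f2 => m m0 _ f1 f2 e1 e2 e3 e4 e5.
apply/eqP; rewrite -(eqn_pmul2l m0); apply/eqP.
have -> : (m * (m.+1 * (f1 + f2)) = m.+1 * (m * f1) + m.+1 * (m * f2))%N
  by ring.
rewrite e1 e5.
apply/eqP; rewrite -(eqr_nat int) !(natrD, natrM, mulrS); apply/eqP.
have {e4}: (n%:R + 1) * d%:R = k%:R * c%:R :> int by rewrite natr1 -!natrM e4.
have {e3}: r%:R + 3 + 3 * n%:R = m%:R :> int.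
  by rewrite -e3 -(natrM _ 3) -!natrD.
have {e2}: k%:R + n%:R = m%:R :> int by rewrite -e2 natrD.
move: (n%:R : int) (r%:R : int) (m%:R : int) (k%:R : int).
move: (c%:R : int) (d%:R : int).
move=> zc zd zn zr zm zk e2 e3 e4.
have {e2}zkE : zk = zm - zn by rewrite -e2; ring.
rewrite zkE in e4.
rewrite -e3 in e4 *.
nia.
Qed.

(** Rothe-Hagen convolution: both sides satisfy the same recursion in [r], so
    the coefficients of a product of powers of [G] are those of the power. *)
Lemma fuss_convolution n r s :
  (\sum_(i < n.+1) fuss i r * fuss (n - i) s = fuss n (r + s))%N.
Proof.
elim: n r => [|n IHn] r; first by rewrite big_ord_recl big_ord0.
elim: r => [|r IHr].
  rewrite big_ord_recl big1 ?addn0 ?mul1n// => i _.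
  by rewrite lift0 fussS0.
rewrite big_ord_recl.
under eq_bigr => i _ do rewrite lift0 fussSS subSS mulnDl.
rewrite big_split addnA.
have -> : (fuss 0 r.+1 * fuss (n.+1 - 0) s = fuss 0 r * fuss (n.+1 - 0) s)%N
  by [].
rewrite big_ord_recl in IHr.
rewrite (eq_bigr (fun i : 'I_n.+1 => fuss i.+1 r * fuss (n - i) s)%N) in IHr;
  last by move=> i _; rewrite lift0 subSS.
by rewrite IHr IHn (addSn r s) fussSS addnAC.
Qed.

Section partial_sums.
Context {R : realType}.
Variable z : R.
Hypothesis z0 : 0 <= z.

Definition fuss_sum (r N : nat) : R := \sum_(n < N) (fuss n r)%:R * z ^+ n.

Let fuss_poly r N : {poly R} := \poly_(i < N) (fuss i r)%:R.

Let fuss_polyE r N : (fuss_poly r N).[z] = fuss_sum r N.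
Proof. by rewrite horner_poly. Qed.

Let coef_fuss_polyM r s N k :
  (fuss_poly r N * fuss_poly s N)`_k <= (fuss k (r + s))%:R
  /\ ((k < N)%N -> (fuss_poly r N * fuss_poly s N)`_k = (fuss k (r + s))%:R).
Proof.
rewrite coefM -fuss_convolution natr_sum; split.
  apply: ler_sum => j _; rewrite !coef_poly natrM.
  by case: ifP; case: ifP; rewrite ?mulr0 ?mul0r -?natrM ?ler0n.
move=> kN; apply: eq_bigr => j _; rewrite !coef_poly natrM.
have jk := ltn_ord j; rewrite !ifT//; lia.
Qed.

Let coef_fuss_polyM_ge0 r s N k : 0 <= (fuss_poly r N * fuss_poly s N)`_k.
Proof.
rewrite coefM; apply: sumr_ge0 => j _; rewrite !coef_poly.
by case: ifP; case: ifP; rewrite ?mulr0 ?mul0r -?natrM ?ler0n.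
Qed.

Let size_fuss_polyM r s N :
  (size (fuss_poly r N * fuss_poly s N)%R <= N + N)%N.
Proof.
apply: (leq_trans (size_polyMleq _ _)); apply: (leq_trans (leq_pred _)).
by apply: leq_add; apply: size_poly.
Qed.

(** All terms being nonnegative, a product of truncated sums lies between the
    truncations of the product; this replaces Cauchy products of series. *)
Lemma fuss_sumM_le r s N :
  fuss_sum r N * fuss_sum s N <= fuss_sum (r + s) (N + N).
Proof.
rewrite -!fuss_polyE -hornerM (horner_coef_wide _ (size_fuss_polyM r s N)).
rewrite fuss_polyE; apply: ler_sum => k _.
by apply: ler_wpM2r; [exact: exprn_ge0|exact: (coef_fuss_polyM r s N k).1].
Qed.

Lemma fuss_sumM_ge r s N :
  fuss_sum (r + s) N <= fuss_sum r N * fuss_sum s N.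
Proof.
rewrite -!fuss_polyE -hornerM (horner_coef_wide _ (size_fuss_polyM r s N)).
rewrite fuss_polyE big_split_ord/= -[leLHS]addr0 lerD//.
  by apply: ler_sum => k _; rewrite (coef_fuss_polyM r s N k).2.
by apply: sumr_ge0 => k _; rewrite mulr_ge0// exprn_ge0.
Qed.

Lemma fuss_sum_ge0 r N : 0 <= fuss_sum r N.
Proof. by apply: sumr_ge0 => k _; rewrite mulr_ge0// exprn_ge0. Qed.

Lemma fuss_sum_nondecreasing r :
  {homo fuss_sum r : m n / (m <= n)%N >-> m <= n}.
Proof.
move=> m n /subnK <-; rewrite addnC /fuss_sum big_split_ord/= lerDl.
by apply: sumr_ge0 => k _; rewrite mulr_ge0// exprn_ge0.
Qed.

Lemma fuss_sum1S N : fuss_sum 1 N.+1 = 1 + z * fuss_sum 3 N.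
Proof.
rewrite /fuss_sum big_ord_recl mulr1 mulr_sumr; congr (_ + _).
by apply: eq_bigr => i _; rewrite lift0 exprS /= big_ord_recl big_ord0 addn0
  mulrCA.
Qed.

Lemma fuss_sum_cube_ge N : fuss_sum 1 N.+1 <= 1 + z * fuss_sum 1 N ^+ 3.
Proof.
rewrite fuss_sum1S lerD2l ler_wpM2l//.
apply: (le_trans (fuss_sumM_ge 1 2 N)); rewrite exprS ler_wpM2l ?fuss_sum_ge0//.
exact: (fuss_sumM_ge 1 1 N).
Qed.

Lemma fuss_sum_cube_le N :
  1 + z * fuss_sum 1 N ^+ 3 <= fuss_sum 1 (N + N + (N + N)).+1.
Proof.
rewrite fuss_sum1S lerD2l ler_wpM2l//.
apply: le_trans (fuss_sumM_le 1 2 (N + N)); rewrite exprS.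
apply: ler_pM; rewrite ?exprn_ge0 ?fuss_sum_ge0//.
  by apply: fuss_sum_nondecreasing; rewrite leq_addr.
exact: (fuss_sumM_le 1 1 N).
Qed.

(** At [z <= 4 / 27] the value 3/2 is mapped below itself by
    [y |-> 1 + z * y ^+ 3], hence bounds all truncated sums; this is also the
    convergence of the series. *)
Lemma fuss_sum_le N : z <= 4 / 27 -> fuss_sum 1 N <= 3 / 2.
Proof.
move=> z1; elim: N => [|N IHN]; first by rewrite /fuss_sum big_ord0; lra.
apply: (le_trans (fuss_sum_cube_ge N)).
have : fuss_sum 1 N ^+ 3 <= (3 / 2) ^+ 3
  by rewrite lerXn2r ?nnegrE ?fuss_sum_ge0//; lra.
have := exprn_ge0 3 (fuss_sum_ge0 1 N).
move: (fuss_sum 1 N ^+ 3) => y y0 y1.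
have : z * y <= 4 / 27 * (3 / 2) ^+ 3 by apply: ler_pM.
lra.
Qed.

Lemma gen_G_fuss : gen_G z = limn (fuss_sum 1).
Proof.
rewrite /gen_G; congr (limn _); apply/funext => N; rewrite /series/= big_mkord.
apply: eq_bigr => n _; congr (_ * _).
have := fuss_bin n 1; rewrite mul1n addnC => /(congr1 (fun k => k%:R : R)).
rewrite natrM => <-; rewrite mulrA mulVf ?mul1r// pnatr_eq0; lia.
Qed.

Hypothesis z1 : z <= 4 / 27.

Let cvg_fuss_sum : fuss_sum 1 @ \oo --> gen_G z.
Proof.
rewrite gen_G_fuss; apply: nondecreasing_is_cvgn.
  by move=> m n; exact: fuss_sum_nondecreasing.
by exists (3 / 2) => _ [N _ <-]; exact: fuss_sum_le.
Qed.

Lemma gen_G_le : gen_G z <= 3 / 2.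
Proof.
rewrite -(cvg_lim _ cvg_fuss_sum)//; apply: limr_le; first by apply/cvg_ex;
  eexists; exact: cvg_fuss_sum.
by apply: nearW => N; exact: fuss_sum_le.
Qed.

Lemma gen_G_ge1 : 1 <= gen_G z.
Proof.
rewrite -(cvg_lim _ cvg_fuss_sum)//; apply: limr_ge; first by apply/cvg_ex;
  eexists; exact: cvg_fuss_sum.
near=> N.
have N0 : (0 < N)%N by near: N; exact: nbhs_infty_gt.
have -> : 1 = fuss_sum 1 1 by rewrite /fuss_sum big_ord1 mulr1.
exact: fuss_sum_nondecreasing.
Unshelve. all: by end_near. Qed.

Lemma gen_G_cubic : gen_G z = 1 + z * gen_G z ^+ 3.
Proof.
have cube : (fun N => 1 + z * fuss_sum 1 N ^+ 3) @ \oo --> 1 + z * gen_G z ^+ 3.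
  apply: cvgD; first exact: cvg_cst.
  apply: cvgM; first exact: cvg_cst.
  by under eq_fun do rewrite exprSr expr2; rewrite exprSr expr2; apply: cvgM;
    [apply: cvgM|]; exact: cvg_fuss_sum.
apply/eqP; rewrite eq_le; apply/andP; split.
  have sh : (fun N => fuss_sum 1 N.+1) @ \oo --> gen_G z by rewrite cvg_shiftS.
  apply: (ler_cvg_to sh cube); apply: nearW => N; exact: fuss_sum_cube_ge.
rewrite -(cvg_lim _ cube)//; apply: limr_le; first by apply/cvg_ex; eexists;
  exact: cube.
apply: nearW => N; apply: (le_trans (fuss_sum_cube_le N)).
rewrite gen_G_fuss; apply: nondecreasing_cvgn_le.
  by move=> m n; exact: fuss_sum_nondecreasing.
by apply/cvg_ex; eexists; exact: cvg_fuss_sum.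
Qed.

End partial_sums.

(** * Vertices and ends of the tree *)

Definition child2 (v : FT) : FT :=
  @Vertex (2%N :: word v) (introT andP (conj
    (ltac:(by rewrite /child_labels; case: ifP) :
       2%N \in child_labels (head 1%N (word v))) (word_ok v))).

Definition child1 (v : FT) : FT := insubd ft_root (1%N :: word v).

Definition children (v : FT) : seq FT :=
  if ft_label v == 1%N then [:: child2 v] else [:: child2 v; child1 v].

Lemma word_child1 v : ft_label v != 1%N -> word (child1 v) = 1%N :: word v.
Proof.
rewrite /ft_label => lv; rewrite /child1 /insubd insubT//=.
by rewrite /child_labels (negbTE lv) !inE/= word_ok.
Qed.

Lemma ft_labelP v : ft_label v = 1%N \/ ft_label v = 2%N.
Proof.
case: v => -[|l s]; rewrite /ft_label /=; first by left.
move=> /andP[+ _]; rewrite /child_labels; case: ifP => _; rewrite !inE.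
  by move/eqP; right.
by case/orP => /eqP; [right|left].
Qed.

Lemma rootP v : (v == ft_root) = (word v == [::]).
Proof. by []. Qed.

Lemma is_childP w v : is_child w v = (w \in children v).
Proof.
rewrite /is_child /children.
have parE l : (w != ft_root) && (ft_parent w == v) -> ft_label w = l ->
    word w = l :: word v.
  case: w => -[|l' s] ok//; rewrite /ft_label/=.
  by move=> /eqP/(congr1 word) /= -> ->.
have c2P : is_child (child2 v) v by rewrite /is_child -val_eqE /=;
  apply/eqP/val_inj.
case: ifPn => [/eqP v1|v1]; apply/idP/idP.
- move=> cw; have lw : ft_label w = 2%N.
    case: w parE cw => -[|l s] ok //= _ /eqP vE; move: (ok).
    rewrite /ft_label /= => /andP[+ _].
    have -> : head 1%N s = 1%N by move: v1; rewrite -vE.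
    by rewrite inE => /eqP.
  by rewrite inE -val_eqE/= (parE _ cw lw).
- by rewrite inE => /eqP ->.
- move=> cw; rewrite !inE -!val_eqE /= word_child1//.
  by case: (ft_labelP w) => /(parE _ cw) ->; rewrite eqxx ?orbT.
- rewrite !inE => /orP[/eqP -> //|/eqP ->].
  rewrite -!val_eqE /= word_child1//=; exact/eqP.
Qed.

Lemma ft_label_child1 v : ft_label v != 1%N -> ft_label (child1 v) = 1%N.
Proof. by move=> v1; rewrite /ft_label word_child1. Qed.

Lemma child2_children v : child2 v \in children v.
Proof. by rewrite /children; case: ifP; rewrite !inE eqxx. Qed.

Lemma uniq_children v : uniq (children v).
Proof.
rewrite /children; case: ifPn => //= v1; rewrite inE andbT -val_eqE /=.
by rewrite word_child1.
Qed.

Lemma children_neq_root c v : c \in children v -> c != ft_root.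
Proof. by rewrite -is_childP => /andP[]. Qed.

Lemma parent_children c v : c \in children v -> ft_parent c = v.
Proof. by rewrite -is_childP => /andP[_ /eqP]. Qed.

Lemma children_parent v : v != ft_root -> v \in children (ft_parent v).
Proof. by move=> v0; rewrite -is_childP /is_child v0 eqxx. Qed.

Lemma ft_depth_child c v : c \in children v -> ft_depth c = (ft_depth v).+1.
Proof.
move=> cv; rewrite -(parent_children cv); have := children_neq_root cv.
by case: (c) => -[].
Qed.

Lemma FT_ind (P : FT -> Prop) : P ft_root ->
  (forall v c, c \in children v -> P v -> P c) -> forall v, P v.
Proof.
move=> P0 PS; suff H n v : ft_depth v = n -> P v by move=> v; exact: H.
elim: n v => [|n IHn] v nv.
  by rewrite (_ : v = ft_root)//; apply/eqP; rewrite rootP; exact/eqP/size0nil.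
have v0 : v != ft_root by apply: contra_eqN nv => /eqP ->.
apply: (PS (ft_parent v)); first exact: children_parent.
by apply: IHn; move: nv; rewrite (ft_depth_child (children_parent v0)) => -[].
Qed.

Lemma ft_depth_end (t : FTend) i : ft_depth (t i) = i.
Proof.
elim: i => [|i IHi]; first by rewrite end_ray0.
by have := end_rayS t i; rewrite is_childP => /ft_depth_child ->; rewrite IHi.
Qed.

Lemma end_children (t : FTend) i : t i.+1 \in children (t i).
Proof. by rewrite -is_childP; exact: end_rayS. Qed.

Definition on_ray (t : FTend) (v : FT) : bool := v == t (ft_depth v).

Lemma on_ray_end (t : FTend) i : on_ray t (t i).
Proof. by rewrite /on_ray ft_depth_end. Qed.

Lemma on_ray_children (t : FTend) i c :
  c \in children (t i) -> on_ray t c = (c == t i.+1).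
Proof. by move=> ct; rewrite /on_ray (ft_depth_child ct) ft_depth_end. Qed.

Lemma on_ray_parent (t : FTend) c v : c \in children v -> on_ray t c ->
  on_ray t v.
Proof.
move=> cv; rewrite /on_ray (ft_depth_child cv) => /eqP ct.
have := end_children t (ft_depth v); rewrite -ct => /parent_children.
by rewrite (parent_children cv) => <-.
Qed.

(** * Harmonic functions on the pascalized tree *)

Section harmonic.
Context {R : realType}.
Implicit Types (phi psi : nat -> FT -> R) (h g : FT -> R) (eta : R) (t : FTend).

(** The root counts as having a parent at which every function vanishes. *)
Definition at_parent (f : FT -> R) (v : FT) : R :=
  if v == ft_root then 0 else f (ft_parent v).

(** The equation of the pascalized tree read in the coordinates [(k, v)], where
    [k] is half the excess of the level over the depth of [v]: a step to a
    child keeps [k], and a step to the parent increases it. *)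
Definition harmonic phi := forall k v,
  phi k v = \sum_(c <- children v) phi k c + at_parent (phi k.+1) v.

(** The equation for [h] that makes [eta ^+ k * h v] harmonic; up to the factor
    [eta ^+ (depth / 2)] it is the eigenvalue equation of the adjacency
    operator of the tree for the eigenvalue [eta ^ (- 1 / 2)], if [eta > 0]. *)
Definition eigen eta h := forall v,
  h v = \sum_(c <- children v) h c + eta * at_parent h v.

Definition nonneg (phi : nat -> FT -> R) := forall k v, 0 <= phi k v.

Lemma at_parent_child f v c : c \in children v -> at_parent f c = f v.
Proof.
move=> cv; rewrite /at_parent (negbTE (children_neq_root cv)).
by rewrite (parent_children cv).
Qed.

Lemma at_parent_ge0 f v : (forall u, 0 <= f u) -> 0 <= at_parent f v.
Proof. by move=> f0; rewrite /at_parent; case: ifP. Qed.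

Lemma at_parentB f g v :
  at_parent (fun u => f u - g u) v = at_parent f v - at_parent g v.
Proof. by rewrite /at_parent; case: ifP; rewrite ?subr0. Qed.

Lemma at_parentZ (a : R) f v :
  at_parent (fun u => a * f u) v = a * at_parent f v.
Proof. by rewrite /at_parent; case: ifP; rewrite ?mulr0. Qed.

Lemma harmonicZ (a : R) phi : harmonic phi -> harmonic (fun k v => a * phi k v).
Proof. by move=> H k v; rewrite H mulrDr mulr_sumr at_parentZ. Qed.

Lemma harmonicB phi psi : harmonic phi -> harmonic psi ->
  harmonic (fun k v => phi k v - psi k v).
Proof.
move=> H1 H2 k v; rewrite H1 H2 sumrB at_parentB.
by rewrite opprD addrACA.
Qed.

Lemma harmonic_shift phi : harmonic phi -> harmonic (fun k => phi k.+1).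
Proof. by move=> H k v; exact: H. Qed.

Lemma eigenZ eta (a : R) h : eigen eta h -> eigen eta (fun v => a * h v).
Proof. by move=> H v; rewrite {1}H mulrDr mulr_sumr at_parentZ mulrCA. Qed.

Lemma eigenB eta h g : eigen eta h -> eigen eta g ->
  eigen eta (fun v => h v - g v).
Proof.
move=> H1 H2 v; rewrite {1}H1 {1}H2 sumrB at_parentB.
by rewrite opprD addrACA mulrBr.
Qed.

Lemma eigen_harmonic eta h :
  eigen eta h -> harmonic (fun k v => eta ^+ k * h v).
Proof.
move=> H k v; rewrite {1}H mulrDr mulr_sumr; congr (_ + _).
by rewrite at_parentZ exprSr mulrA.
Qed.

Lemma harmonic_child_le phi k v c : harmonic phi -> nonneg phi ->
  c \in children v -> phi k c <= phi k v.
Proof.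
move=> H phi0 cv; rewrite (H k v) (bigD1_seq c) ?uniq_children//= -addrA lerDl.
by rewrite addr_ge0 ?sumr_ge0// at_parent_ge0.
Qed.

(** A path may step to a child and come back. *)
Lemma harmonicS_le phi k v : harmonic phi -> nonneg phi ->
  phi k.+1 v <= phi k v.
Proof.
move=> H phi0; have cv := child2_children v.
apply: le_trans (harmonic_child_le k H phi0 cv).
by rewrite (H k (child2 v)) (at_parent_child _ cv) lerDr sumr_ge0.
Qed.

Lemma harmonic_eq0 phi : harmonic phi -> nonneg phi -> phi 0%N ft_root = 0 ->
  forall k v, phi k v = 0.
Proof.
move=> H phi0 phi00 k v; apply/eqP; rewrite eq_le phi0 andbT.
elim/FT_ind: v => [|v c cv];
  last exact: le_trans (harmonic_child_le k H phi0 cv).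
elim: k => [|k]; first by rewrite phi00.
exact: le_trans (harmonicS_le k _ H phi0).
Qed.

Lemma eigen_pos eta h : 0 < eta -> eigen eta h -> (forall v, 0 <= h v) ->
  0 < h ft_root -> forall v, 0 < h v.
Proof.
move=> eta0 H h0 hr; elim/FT_ind => // v c cv hv.
rewrite H (at_parent_child _ cv) ltr_wpDl ?sumr_ge0// mulr_gt0//.
Qed.

Lemma eigen_eq0 eta h : 0 <= eta -> eigen eta h -> (forall v, 0 <= h v) ->
  h ft_root = 0 -> forall v, h v = 0.
Proof.
move=> eta0 H h0 hr v.
have := harmonic_eq0 (eigen_harmonic H) _ _ 0%N v; rewrite !expr0 !mul1r;
  apply=> //.
by move=> k w; rewrite mulr_ge0 ?exprn_ge0.
Qed.

Lemma sum_children (F : nat -> R) v :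
  \sum_(c <- children v) F (ft_label c) =
  F 2%N + (if ft_label v == 1%N then 0 else F 1%N).
Proof.
rewrite /children; case: ifPn => v1; first by rewrite big_seq1 addr0.
by rewrite big_cons big_seq1 (ft_label_child1 v1).
Qed.

(** With [r1] and [r2] the infima of [h child / h parent] over the children of
    label 1 and 2, the equation at a vertex [c] bounds [h c / h (parent c)]
    from below in terms of the ratios at the children of [c], that is of [r1]
    and [r2]. Taking the infimum over [c] gives [eta <= r1 * (1 - r2)] for
    label 1 and [eta <= r2 * (1 - r2 - r1)] for label 2; eliminating [r1] from
    the latter bounds [eta] by a function of [r2] alone. *)
Lemma eigen_ratio eta h : 0 < eta -> eigen eta h -> (forall v, 0 <= h v) ->
    0 < h ft_root -> exists r1 r2 : R,
  [/\ 0 < 1 - r2, eta <= r1 * (1 - r2), eta <= (1 - r2) ^+ 2 * r2 &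
   forall v c, c \in children v ->
     (if ft_label c == 1%N then r1 else r2) * h v <= h c].
Proof.
move=> eta0 H h0 hr; have hp := eigen_pos eta0 H h0 hr.
pose E l := [set h c / at_parent h c |
  c in [set c | c != ft_root /\ ft_label c = l]].
pose r l := inf (E l).
have atp c : c != ft_root -> 0 < at_parent h c.
  by move=> c0; rewrite /at_parent (negbTE c0).
have Elb l : has_lbound (E l).
  exists 0 => _ [c [c0 _] <-]; rewrite divr_ge0//; exact/ltW/atp.
have a1 : ft_label vertex_a != 1%N by [].
have c1a : child1 vertex_a \in children vertex_a
  by rewrite /children (negbTE a1) !inE eqxx orbT.
have EN0 l : l = 1%N \/ l = 2%N -> E l !=set0.
  case=> ->; first exists (h (child1 vertex_a) / at_parent h (child1 vertex_a)).
    by exists (child1 vertex_a) => //; split;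
      rewrite ?ft_label_child1 ?(children_neq_root c1a).
  by exists (h vertex_a / at_parent h vertex_a); exists vertex_a.
have rle c : c != ft_root -> r (ft_label c) * at_parent h c <= h c.
  by move=> c0; rewrite -ler_pdivlMr ?atp//; apply: ge_inf => //; exists c.
have rge l b : l = 1%N \/ l = 2%N ->
    (forall c, c != ft_root -> ft_label c = l -> b * at_parent h c <= h c) ->
    b <= r l.
  move=> l12 Hb; apply: lb_le_inf; first exact: EN0.
  by move=> _ [c [c0 lc] <-]; rewrite ler_pdivlMr ?Hb// atp.
have r0 l : l = 1%N \/ l = 2%N -> 0 <= r l.
  by move=> l12; apply: rge => // c c0 _; rewrite mul0r.
have step c : c != ft_root -> eta * at_parent h c <=
    h c * (1 - r 2%N - (if ft_label c == 1%N then 0 else r 1%N)).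
  move=> c0; have := H c => hc.
  have : \sum_(d <- children c) r (ft_label d) * h c <=
         \sum_(d <- children c) h d.
    rewrite big_seq [leRHS]big_seq; apply: ler_sum => d dc.
    by have := rle _ (children_neq_root dc); rewrite (at_parent_child _ dc).
  rewrite -mulr_suml sum_children; move: hc.
  move: (\sum_(d <- _) _) (at_parent h c) => S A; case: ifP => _; nra.
have step1 l : l = 1%N \/ l = 2%N ->
    eta <= r l * (1 - r 2%N - (if l == 1%N then 0 else r 1%N)).
  move=> l12; set d := 1 - _ - _.
  (* If [d <= 0] then the inequality at any vertex of label [l] is absurd. *)
  have [d0|d0] := leP d 0.
    case: (EN0 _ l12) => _ [c [c0 lc] _].
    have := step c c0; rewrite lc -/d => hd.
    have := mulr_gt0 eta0 (atp _ c0).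
    have : h c * d <= 0 by rewrite mulr_ge0_le0.
    lra.
  rewrite -ler_pdivrMr//; apply: rge => // c c0 lc.
  have := step c c0; rewrite lc -/d => hd.
  by rewrite mulrAC ler_pdivrMr.
have e1 := step1 1%N (or_introl erefl); rewrite /= subr0 in e1.
have e2 : eta <= r 2%N * (1 - r 2%N - r 1%N) := step1 2%N (or_intror erefl).
have r10 : 0 <= r 1%N by apply: r0; left.
have r20 : 0 <= r 2%N by apply: r0; right.
have {}rle v c : c \in children v ->
    (if ft_label c == 1%N then r 1%N else r 2%N) * h v <= h c.
  move=> cv; have := rle _ (children_neq_root cv).
  rewrite (at_parent_child _ cv).
  by case: (ft_labelP c) => ->.
exists (r 1%N), (r 2%N).
move: (r 1%N) (r 2%N) r10 r20 e1 e2 rle => r1 r2 r10 r20 e1 e2 rle.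
have x0 : 0 < 1 - r2 - r1.
  by rewrite ltNge; apply/negP => x0; have := mulr_ge0_le0 r20 x0; lra.
split.
- lra.
- by [].
- nra.
- exact: rle.
Qed.

(** The maximum of [x ^+ 2 * (1 - x)] over [x >= 0] is 4/27, attained at
    2/3. *)
Lemma eigen_eta_le eta h : 0 <= eta -> eigen eta h -> (forall v, 0 <= h v) ->
  0 < h ft_root -> eta <= 4 / 27.
Proof.
rewrite le_eqVlt => /orP[/eqP <- _ _ _|eta0 H h0 hr]; first lra.
have [r1 [r2 [x0 _ ex _]]] := eigen_ratio eta0 H h0 hr.
move: ex.
have r2E : r2 = 1 - (1 - r2) by ring.
rewrite [X in _ * X]r2E; move: (1 - r2) x0 => x x0 ex.
have : 0 <= (x - 2 / 3) ^+ 2 * (x + 1 / 3) by rewrite mulr_ge0 ?sqr_ge0//; lra.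
lra.
Qed.

Section generating_function.
Variable eta : R.
Hypotheses (eta0 : 0 <= eta) (eta1 : eta <= 4 / 27).
Let G := gen_G eta.

Lemma gen_G_gt0 : 0 < G.
Proof. exact: lt_le_trans (gen_G_ge1 eta0 eta1). Qed.

(** Off the ray these are the transition probabilities of the walk: the cubic
    equation of [G] is the statement that they sum to one at a vertex. *)
Lemma sum_children_gen_G v :
  \sum_(c <- children v) eta * G ^+ ft_label c = 1 - G ^- ft_label v.
Proof.
have Gp := gen_G_gt0; have Gn0 := lt0r_neq0 Gp.
have cub : G = 1 + eta * G ^+ 3 := gen_G_cubic eta0 eta1.
have e2 : eta * G ^+ 2 = 1 - G^-1.
  apply: (mulIf Gn0); rewrite mulrBl mulVf// mul1r -mulrA -exprSr.
  by rewrite [X in _ = X - 1]cub; ring.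
rewrite (sum_children (fun l => eta * G ^+ l)) e2.
case: (ft_labelP v) => -> /=; first by rewrite addr0.
apply: (mulIf Gn0); rewrite mulrDl mulrBl mulVf// expr1 -mulrA -expr2 e2.
by rewrite mulrBl expr2 invfM -mulrA mulVf// mulr1 !mul1r; ring.
Qed.

(** The number [1 - r2] of [eigen_ratio] lies between the two roots of
    [x ^+ 2 * (1 - x) = eta] in the unit interval, and [G^-1] is the larger
    one, because it is at least 2/3. So [r2] is at least
    [1 - G^-1 = eta * G ^+ 2], and the other inequality then bounds [r1] by
    [eta * G]. *)
Lemma eigen_gen_G_le h : eigen eta h -> (forall v, 0 <= h v) ->
  forall v c, c \in children v -> eta * G ^+ ft_label c * h v <= h c.
Proof.
move=> H h0 v c cv.
have [hr|] := eqVneq (h ft_root) 0.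
  by rewrite !(eigen_eq0 eta0 H h0 hr) mulr0.
rewrite neq_lt ltNge h0 /= => hr.
have [<-|etaN0] := eqVneq 0 eta; first by rewrite !mul0r.
have etap : 0 < eta by rewrite lt_neqAle etaN0.
have [r1 [r2 [x0 e1 ex /(_ v c cv)]]] := eigen_ratio etap H h0 hr.
apply: le_trans; apply: ler_wpM2r => //.
have Gp := gen_G_gt0; have Gn0 := lt0r_neq0 Gp.
have G1 : 1 <= G := gen_G_ge1 eta0 eta1.
have G2 : G <= 3 / 2 := gen_G_le eta0 eta1.
have cub : G = 1 + eta * G ^+ 3 := gen_G_cubic eta0 eta1.
(* In terms of [y] the cubic equation of [G] reads [eta = y ^+ 2 * (1 - y)]. *)
pose y := G^-1.
have Gy : G * y = 1 by rewrite mulfV.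
have yge : 2 / 3 <= y.
  by rewrite /y -[leLHS]invrK lef_pV2 ?posrE// invf_div.
have ey : eta = y ^+ 2 * (1 - y).
  have : G * y ^+ 3 = y ^+ 3 + eta * (G * y) ^+ 3 by rewrite {1}cub; ring.
  rewrite Gy expr1n mulr1 exprS mulrA Gy mul1r => E; lra.
have xy : 1 - r2 <= y.
  rewrite leNgt; apply/negP => yx.
  have : (1 - r2) ^+ 2 * r2 < y ^+ 2 * (1 - y); last by rewrite -ey ltNge ex.
  have r2E : r2 = 1 - (1 - r2) by ring.
  rewrite [X in _ * X]r2E; move: (1 - r2) yx => x yx.
  rewrite -subr_gt0.
  have -> : y ^+ 2 * (1 - y) - x ^+ 2 * (1 - x) =
     (x - y) * (x * x + x * y + y * y - x - y) by ring.
  apply: mulr_gt0; first lra.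
  nra.
have eG : eta * G <= r1.
  have : eta * G * y <= r1 * y by rewrite -mulrA Gy mulr1; nra.
  by rewrite ler_pM2r// /y invr_gt0.
case: (ft_labelP c) => -> //=.
have -> : eta * G ^+ 2 = 1 - y.
  rewrite ey expr2.
  have -> : y ^+ 2 * (1 - y) * (G * G) = (1 - y) * ((G * y) * (G * y)) by ring.
  by rewrite Gy !mulr1.
lra.
Qed.

End generating_function.
End harmonic.

(** * Extremal harmonic functions *)

Section extremal.
Context {R : realType}.
Implicit Types (phi psi : nat -> FT -> R) (h g : FT -> R) (eta : R) (t : FTend).

Definition extremal phi := forall psi, harmonic psi ->
  (forall k v, 0 <= psi k v <= phi k v) ->
  forall k v, psi k v = psi 0%N ft_root * phi k v.

(** Away from the ray, [h] decays as fast as [eigen_gen_G_le] allows. *)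
Definition off_ray eta t h := forall v c, c \in children v -> ~~ on_ray t c ->
  h c = eta * gen_G eta ^+ ft_label c * h v.

(** Along the ray the equation at a vertex gives the value at the next vertex,
    all other children being off the ray. *)
Lemma off_ray_eigen_unique eta t h g : eigen eta h -> eigen eta g ->
  off_ray eta t h -> off_ray eta t g -> h ft_root = g ft_root -> h =1 g.
Proof.
move=> H1 H2 O1 O2 E0.
suff H : forall i, (forall v, ft_depth v <= i -> h v = g v)%N.
  by move=> v; exact: (H (ft_depth v)).
elim=> [|i IHi] v vi.
  by have /eqP -> : v == ft_root by rewrite rootP -size_eq0 -leqn0.
have [->//|v0] := eqVneq v ft_root.
have vp := children_parent v0.
have pi : (ft_depth (ft_parent v) <= i)%N by rewrite -ltnS -(ft_depth_child vp).
have [vt|vt] := boolP (on_ray t v);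
  last by rewrite (O1 _ _ vp)// (O2 _ _ vp)// IHi.
have E : at_parent h (ft_parent v) = at_parent g (ft_parent v).
  rewrite /at_parent; case: ifPn => // p0; apply: IHi; apply: leq_trans pi.
  by rewrite (ft_depth_child (children_parent p0)).
have := H1 (ft_parent v); have := H2 (ft_parent v).
rewrite E IHi// => -> /addIr.
rewrite !(bigD1_seq v) ?uniq_children//= => /esym E1.
apply: (addIr (\sum_(i <- children (ft_parent v) | i != v) g i)).
rewrite -[RHS]E1; congr (_ + _).
rewrite big_seq_cond [RHS]big_seq_cond; apply: eq_bigr => c /andP[cp cv].
have ct : ~~ on_ray t c.
  apply: contra cv => /eqP ->; rewrite (ft_depth_child cp) -(ft_depth_child vp).
  by rewrite eq_sym.
by rewrite (O1 _ _ cp)// (O2 _ _ cp)// IHi.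
Qed.

(** An argument of Choquet-Deny type. Let [D k v = eta * psi k v - psi k.+1 v]
    and let [m] be the supremum of [D] relative to the harmonic function
    [x k v = eta ^+ k * h v]. Then [m * x - D] is nonnegative and harmonic,
    hence decreases in [k]; where it is nearly zero, it remains so for many
    values of [k], and then [D] stays above [m / 2 * x]. As [eta ^- k * D k v]
    telescopes and [psi <= x], this is impossible if [m > 0]. *)
Lemma dominated_shift_ge eta h psi : 0 < eta -> eta <= 1 -> eigen eta h ->
  (forall v, 0 < h v) -> harmonic psi ->
  (forall k v, 0 <= psi k v <= eta ^+ k * h v) ->
  forall k v, eta * psi k v <= psi k.+1 v.
Proof.
move=> eta0 eta1 eig hp harm dom k0 v0; rewrite leNgt; apply/negP => lt0.
pose x k v := eta ^+ k * h v.
have xp k v : 0 < x k v by rewrite mulr_gt0// exprn_gt0.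
pose D k v := eta * psi k v - psi k.+1 v.
pose Q := [set q | exists k v, q = D k v / x k v].
have Qub : ubound Q eta.
  move=> _ [k [v ->]]; rewrite ler_pdivrMr// /D lerBlDr.
  have /andP[_ le1] := dom k v; have /andP[ge0 _] := dom k.+1 v.
  by rewrite -[leLHS]addr0 lerD// ler_pM2l.
have Qsup : has_sup Q by split; [exists (D k0 v0 / x k0 v0), k0, v0|exists eta].
pose m := sup Q.
have Qm k v : D k v <= m * x k v.
  by rewrite -ler_pdivrMr//; apply: sup_upper_bound => //; exists k, v.
have m0 : 0 < m.
  apply: (@lt_le_trans _ _ (D k0 v0 / x k0 v0)).
    by rewrite divr_gt0// subr_gt0.
  by apply: sup_upper_bound => //; exists k0, v0.
(* After [K] steps the telescoped sum exceeds its bound [eta]. *)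
have [K HK] : exists K : nat, eta < K%:R * (m / 2).
  exists (Num.trunc (eta / (m / 2))).+1; rewrite -ltr_pdivrMr ?divr_gt0//.
  by apply: truncnS_gt.
(* This precision is still below [m * eta ^+ j / 2] after [j <= K] steps. *)
have e0 : 0 < m * eta ^+ K / 2 by rewrite divr_gt0// mulr_gt0// exprn_gt0.
have [_ [k [v ->]]] := sup_adherent e0 Qsup; rewrite -/m => HE.
pose E k v := m * x k v - D k v.
have Eharm : harmonic E.
  apply: harmonicB; first by apply: harmonicZ; exact: eigen_harmonic.
  by apply: harmonicB; [exact: harmonicZ|exact: harmonic_shift].
have E0 : nonneg E by move=> i w; rewrite subr_ge0.
have Ele j : E (k + j)%N v <= m * eta ^+ K / 2 * x k v.
  elim: j => [|j]; last by rewrite addnS; apply: le_trans; exact: harmonicS_le.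
  rewrite addn0 /E; move: HE; rewrite ltr_pdivlMr// mulrBl => /ltW; lra.
have main j : (j <= K)%N ->
    eta * psi (k + j)%N v <=
    eta ^+ j * (eta * psi k v - j%:R * (m / 2) * x k v).
  elim: j => [_|j IHj jK]; first by rewrite addn0 mul0r mul0r subr0 mul1r.
  have := IHj (ltnW jK); have := Ele j; rewrite /E /D addnS.
  have -> : x (k + j)%N v = eta ^+ j * x k v
    by rewrite /x exprD mulrA (mulrC (eta ^+ j)).
  have ej : eta ^+ K <= eta ^+ j by rewrite ler_wiXn2l ?(ltW eta0)// ltnW.
  have : m * eta ^+ K / 2 * x k v <= m * eta ^+ j / 2 * x k v.
    by rewrite ler_pM2r// ler_pM2r// ler_pM2l.
  rewrite exprS -[j.+1%:R]natr1 => l1 l2 l3.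
  rewrite -mulrA ler_pM2l//.
  move: l1 l2 l3; move: (eta ^+ j) (eta ^+ K) (psi _ _) (psi _ _) (psi _ _) =>
    *.
  lra.
have := main K (leqnn K).
have /andP[p0 _] := dom (k + K)%N v.
have : 0 <= eta * psi (k + K)%N v by rewrite mulr_ge0// ltW.
move=> /le_trans h1 /h1; rewrite pmulr_rge0 ?exprn_gt0// subr_ge0.
have /andP[_ p1] := dom k v; move/le_trans => h2.
have := h2 _ (ler_wpM2l (ltW eta0) p1).
by rewrite ler_pM2r// leNgt HK.
Qed.

(** The reverse inequality is the previous one for the complement
    [eta ^+ k * h v - psi k v]. *)
Lemma dominated_shift eta h psi : 0 <= eta <= 4 / 27 -> eigen eta h ->
  (forall v, 0 <= h v) -> harmonic psi ->
  (forall k v, 0 <= psi k v <= eta ^+ k * h v) ->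
  forall k v, psi k.+1 v = eta * psi k v.
Proof.
move=> /andP[eta0 eta1] eig h0 harm dom k v.
have phar := eigen_harmonic eig.
have psi0 : nonneg psi by move=> i w; have /andP[] := dom i w.
have [hr|] := eqVneq (h ft_root) 0.
  suff psi00 : psi 0%N ft_root = 0
    by rewrite !(harmonic_eq0 harm psi0 psi00) mulr0.
  apply/eqP; rewrite eq_le psi0 andbT.
  by have /andP[_] := dom 0%N ft_root; rewrite hr mulr0.
rewrite neq_lt ltNge h0 /= => hr.
move: eta0; rewrite le_eqVlt => /orP[/eqP e0|eta0].
  have /andP[] := dom k.+1 v; rewrite -e0 exprS !mul0r => *.
  by apply/eqP; rewrite eq_le; apply/andP.
have hp := eigen_pos eta0 eig h0 hr.
have eta2 : eta <= 1 by lra.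
apply/eqP; rewrite eq_le (dominated_shift_ge eta0 eta2 eig hp harm dom) andbT.
have dom' i w : 0 <= eta ^+ i * h w - psi i w <= eta ^+ i * h w.
  by have /andP[? ?] := dom i w; apply/andP; split; lra.
have := dominated_shift_ge eta0 eta2 eig hp (harmonicB phar harm) dom' k v.
by rewrite exprS; lra.
Qed.

(** A harmonic function below [eta ^+ k * h v] has the same form
    [eta ^+ k * g v]. Both [g] and [h - g] satisfy the lower bound of
    [eigen_gen_G_le]; where it is an equality for [h], it is one for [g]. *)
Lemma off_ray_extremal eta t h : 0 <= eta <= 4 / 27 -> eigen eta h ->
  (forall v, 0 <= h v) -> h ft_root = 1 -> off_ray eta t h ->
  extremal (fun k v => eta ^+ k * h v).
Proof.
move=> eta01 eig h0 hr off psi harm dom.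
have /andP[eta0 eta1] := eta01.
have shift := dominated_shift eta01 eig h0 harm dom.
have psiE k v : psi k v = eta ^+ k * psi 0%N v.
  by elim: k => [|k IHk]; rewrite ?mul1r// shift IHk exprS mulrA.
have geig : eigen eta (psi 0%N).
  move=> v; rewrite {1}harm; congr (_ + _).
  by rewrite /at_parent; case: ifP; rewrite ?mulr0.
have g0 v : 0 <= psi 0%N v by have /andP[] := dom 0%N v.
have gh v : 0 <= h v - psi 0%N v.
  by have /andP[_] := dom 0%N v; rewrite mul1r subr_ge0.
have goff : off_ray eta t (psi 0%N).
  move=> v c cv ct; apply/eqP; rewrite eq_le eigen_gen_G_le// andbT.
  have := eigen_gen_G_le eta0 eta1 (eigenB eig geig) gh cv.
  by rewrite (off _ _ cv ct) mulrBr; lra.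
move=> k v; rewrite psiE mulrCA; congr (_ * _).
apply: (off_ray_eigen_unique geig (eigenZ (psi 0%N ft_root) eig) goff).
  by move=> {}v c cv ct; rewrite (off _ _ cv ct) mulrCA.
by rewrite hr mulr1.
Qed.

Definition descends (w v : FT) : bool := suffix (word w) (word v).

Lemma descends_refl v : descends v v.
Proof. exact: suffix_refl. Qed.

Lemma descends_root v : descends ft_root v.
Proof. exact: suffix0s. Qed.

Lemma word_children c v : c \in children v -> word c = ft_label c :: word v.
Proof.
move=> cv; have := children_neq_root cv; rewrite -(parent_children cv).
by case: c {cv} => -[].
Qed.

Lemma descends_child w v c : c \in children v ->
  descends w c = (w == c) || descends w v.
Proof.
move=> cv; rewrite /descends (word_children cv) -val_eqE /= (word_children cv).
apply/idP/idP.
  case/suffixP => -[|l s] /=; first by move=> ->; rewrite eqxx.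
  by move=> [_ ->]; rewrite suffix_suffix orbT.
case/orP => [/eqP -> |/suffixP[s ->]]; first exact: suffix_refl.
by rewrite -cat_cons suffix_suffix.
Qed.

Lemma descends_depth w v : descends w v -> (ft_depth w <= ft_depth v)%N.
Proof.
by move=> /suffixP[s]; rewrite /ft_depth => ->; rewrite size_cat leq_addl.
Qed.

Lemma descends_depth_eq w v : descends w v -> ft_depth w = ft_depth v -> w = v.
Proof.
rewrite /descends => /suffixP[s] E; rewrite /ft_depth E size_cat => H.
apply/val_inj; rewrite /= E; suff -> : s = [::] by [].
by apply: size0nil; apply: (@addIn (size (word w))); rewrite add0n -H.
Qed.

Lemma descends_trans u v w : descends u v -> descends v w -> descends u w.
Proof.
by rewrite /descends => /suffixP[s ->] /suffixP[s' E];
  rewrite E catA suffix_suffix.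
Qed.

Lemma descends_step v w : descends v w -> v != w ->
  exists2 c, c \in children v & descends c w.
Proof.
elim/FT_ind: w => [|u c cu IHu].
  move=> vr; have := descends_depth_eq vr; have := descends_depth vr.
  by rewrite leqn0 => /eqP -> /(_ erefl) ->; rewrite eqxx.
rewrite (descends_child _ cu) => /orP[->//|vu] vc.
have [E|vNu] := eqVneq v u; first by exists c; rewrite ?descends_refl ?E.
have [d dv du] := IHu vu vNu; exists d => //.
by rewrite (descends_child _ cu) du orbT.
Qed.

Lemma descends_parent c v w : c \in children v -> descends c w -> descends v w.
Proof.
move=> cv; apply: descends_trans.
by rewrite (descends_child _ cv) descends_refl orbT.
Qed.

Lemma descends_same c d w : descends c w -> descends d w ->
  ft_depth c = ft_depth d -> c = d.
Proof.
move=> /suffixP[s E] /suffixP[s']; rewrite E => E' cd; apply/val_inj => /=.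
have/eqP := E'; rewrite eqseq_cat; first by case/andP => _ /eqP.
have := congr1 size E'; rewrite !size_cat.
by rewrite -[size (word c)]/(ft_depth c) cd => /addIn.
Qed.

(** The part of a flow that passes through [w]. *)
Definition cut (M : FT -> R) (w v : FT) : R :=
  if descends w v then M v else if descends v w then M w else 0.

(** A nonnegative flow is a finite measure on the ends of the tree, [M v] being
    the measure of the ends beyond [v]. *)
Definition flow (M : FT -> R) := forall v, M v = \sum_(c <- children v) M c.

Lemma flow_cut M w : flow M -> flow (cut M w).
Proof.
move=> F v; rewrite /cut; case: ifPn => wv.
  rewrite F big_seq [RHS]big_seq; apply: eq_bigr => c cv.
  by rewrite (descends_child _ cv) wv orbT.
case: ifPn => vw.
  have vNw : v != w by apply: contraNneq wv => ->; exact: descends_refl.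
  have [c0 c0v c0w] := descends_step vw vNw.
  rewrite (bigD1_seq c0) ?uniq_children//= c0w big_seq_cond big1 ?addr0.
    by rewrite (descends_child _ c0v) (negbTE wv) orbF; case: eqP => [->|].
  move=> c /andP[cv cc0]; rewrite (descends_child _ cv) (negbTE wv) orbF.
  have cw : descends c w = false.
    apply: contraNF cc0 => cw; apply/eqP/(descends_same cw c0w).
    by rewrite (ft_depth_child cv) (ft_depth_child c0v).
  rewrite cw; case: eqP => // E.
  by move: cw; rewrite E descends_refl.
rewrite big_seq big1// => c cv.
have cw : descends c w = false by apply: contraNF vw => /(descends_parent cv).
rewrite cw (descends_child _ cv) (negbTE wv) orbF; case: eqP => // E.
by move: cw; rewrite E descends_refl.
Qed.

Lemma flow_le M v w : (forall u, 0 <= M u) -> flow M -> descends v w ->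
  M w <= M v.
Proof.
move=> M0 F; elim/FT_ind: w => [|u c cu IHu].
  move=> vr; have := descends_depth_eq vr; have := descends_depth vr.
  by rewrite leqn0 => /eqP -> /(_ erefl) ->.
rewrite (descends_child _ cu) => /orP[/eqP ->//|/IHu]; apply: le_trans.
by rewrite (F u) (bigD1_seq c) ?uniq_children//= lerDl sumr_ge0.
Qed.

Lemma cut_le M w v : (forall u, 0 <= M u) -> flow M -> 0 <= cut M w v <= M v.
Proof.
move=> M0 F; rewrite /cut; case: ifP => [_|_]; first by rewrite M0 lexx.
by case: ifP => [vw|_]; rewrite M0 ?lexx// flow_le.
Qed.

Section boundary.
Variable eta : R.
Hypotheses (eta0 : 0 <= eta) (eta1 : eta <= 4 / 27).
Let G := gen_G eta.
Let Gp : 0 < G. Proof. exact: gen_G_gt0. Qed.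

(** The excess of [h] over the lower bound of [eigen_gen_G_le]; at the root it
    is the value of [h]. *)
Definition defect h (v : FT) : R := h v - eta * G ^+ ft_label v * at_parent h v.

Fixpoint unroll_word (d : FT -> R) (s : seq nat) : R :=
  d (insubd ft_root s) +
  (if s is l :: s' then eta * G ^+ l * unroll_word d s' else 0).

(** The inverse of [defect]. *)
Definition unroll (d : FT -> R) (v : FT) := unroll_word d (word v).

Lemma unrollE d v :
  unroll d v = d v + eta * G ^+ ft_label v * at_parent (unroll d) v.
Proof.
rewrite -{2}(valKd ft_root v) /=; case: v => -[|l s] ok.
  by rewrite /at_parent /= mulr0.
by rewrite /at_parent /unroll /=.
Qed.

Lemma defect_unroll d : defect (unroll d) =1 d.
Proof. by move=> v; rewrite /defect unrollE addrK. Qed.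

Lemma sum_children_defect h v :
  \sum_(c <- children v) h c =
  \sum_(c <- children v) defect h c + (1 - G ^- ft_label v) * h v.
Proof.
rewrite -(sum_children_gen_G eta0 eta1) mulr_suml -big_split/=.
rewrite big_seq [RHS]big_seq; apply: eq_bigr => c cv.
by rewrite /defect (at_parent_child _ cv) subrK.
Qed.

(** In terms of the defects the equation no longer mentions the parent, so that
    it is a flow equation up to the weights [G ^+ label]. *)
Lemma eigen_defect h : eigen eta h <->
  forall v, defect h v = G ^+ ft_label v * \sum_(c <- children v) defect h c.
Proof.
have Gn v : G ^+ ft_label v * G ^- ft_label v = 1.
  by rewrite mulfV// expf_neq0// lt0r_neq0.
split=> H v.
  have S := sum_children_defect h v; have hv := H v; have xy := Gn v.
  have T : \sum_(c <- children v) defect h c =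
      G ^- ft_label v * h v - eta * at_parent h v.
    by move: S hv; rewrite mulrBl mul1r; lra.
  by rewrite T mulrBr mulrA xy mul1r /defect; ring.
have S := sum_children_defect h v; have yx := Gn v; rewrite mulrC in yx.
have : G ^- ft_label v * defect h v = \sum_(c <- children v) defect h c.
  by rewrite H mulrA yx mul1r.
rewrite /defect mulrBr [X in _ - X](_ : _ = eta * at_parent h v); last first.
  rewrite mulrC -!mulrA [at_parent h v * _]mulrC [_ ^+ _ * _]mulrA.
  by rewrite [_ ^+ _ * _]mulrC yx mul1r.
by move: S; rewrite mulrBl mul1r; lra.
Qed.

(** The product of the factors of [eigen_defect] over the strict ancestors,
    which turns that equation into a flow equation. *)
Fixpoint weight_word (s : seq nat) : R :=
  if s is _ :: s' then weight_word s' * G ^+ head 1%N s' else 1.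

Definition weight (v : FT) : R := weight_word (word v).

Lemma weight_child v c : c \in children v ->
  weight c = weight v * G ^+ ft_label v.
Proof. by move=> cv; rewrite /weight (word_children cv). Qed.

Lemma weight_gt0 v : 0 < weight v.
Proof.
elim/FT_ind: v => [|v c cv]; first exact: ltr01.
by move=> ?; rewrite (weight_child cv) mulr_gt0// exprn_gt0.
Qed.

(** The measure on ends represented by [h]. *)
Definition mass h (v : FT) : R := weight v * defect h v.

Lemma flow_mass h : eigen eta h -> flow (mass h).
Proof.
move=> /eigen_defect H v; rewrite /mass H mulrA mulr_sumr.
rewrite big_seq [RHS]big_seq; apply: eq_bigr => c cv.
by rewrite (weight_child cv).
Qed.

Lemma eigen_unroll M : flow M -> eigen eta (unroll (fun v => M v / weight v)).
Proof.
move=> F; apply/eigen_defect => v;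
  rewrite defect_unroll (F v) mulr_suml mulr_sumr.
rewrite big_seq [RHS]big_seq; apply: eq_bigr => c cv.
have x0 : G ^+ ft_label v != 0 by rewrite expf_neq0// lt0r_neq0.
have w0 := lt0r_neq0 (weight_gt0 v).
rewrite defect_unroll (weight_child cv); move: (G ^+ _) x0 => x x0.
by field; rewrite x0 w0.
Qed.

Lemma defect_ge0 h v : eigen eta h -> (forall u, 0 <= h u) -> 0 <= defect h v.
Proof.
move=> H h0; rewrite /defect subr_ge0.
have [->|v0] := eqVneq v ft_root; first by rewrite /at_parent eqxx mulr0.
have vp := children_parent v0.
by rewrite (at_parent_child _ vp) eigen_gen_G_le.
Qed.

Lemma mass_ge0 h v : eigen eta h -> (forall u, 0 <= h u) -> 0 <= mass h v.
Proof. by move=> H h0; rewrite mulr_ge0 ?defect_ge0// ltW// weight_gt0. Qed.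

Lemma mass_root h : mass h ft_root = h ft_root.
Proof. by rewrite /mass mul1r /defect /at_parent eqxx mulr0 subr0. Qed.

Lemma unroll_le d h : eigen eta h -> (forall u, 0 <= h u) ->
  (forall v, 0 <= d v <= defect h v) -> forall v, 0 <= unroll d v <= h v.
Proof.
move=> H h0 dom; elim/FT_ind => [|v c cv /andP[IH1 IH2]]; rewrite unrollE.
  have /andP[d0 d1] := dom ft_root; move: d1.
  by rewrite /defect /at_parent eqxx mulr0 subr0 addr0 d0.
have /andP[d0 d1] := dom c; move: d1;
  rewrite /defect !(at_parent_child _ cv) => d1.
have F0 : 0 <= eta * G ^+ ft_label c by rewrite mulr_ge0// exprn_ge0// ltW.
apply/andP; split; first by rewrite addr_ge0// mulr_ge0.
by rewrite -lerBrDr (le_trans d1)// lerD2l lerN2 ler_wpM2l.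
Qed.

(** The part of the mass that passes through [w] defines a solution below [h].
    By extremality it is proportional to [h], but it has no mass at [v]. *)
Lemma extremal_mass h v w : eigen eta h -> (forall u, 0 <= h u) ->
  h ft_root = 1 -> extremal (fun k v => eta ^+ k * h v) ->
  ~~ descends v w -> ~~ descends w v -> mass h v * mass h w = 0.
Proof.
move=> H h0 hr ext vw wv.
pose d u := cut (mass h) w u / weight u.
have F := flow_mass H.
have M0 u : 0 <= mass h u by exact: mass_ge0.
have dom u : 0 <= d u <= defect h u.
  have /andP[c0 c1] := cut_le w u M0 F.
  apply/andP; split; first by rewrite divr_ge0// ltW// weight_gt0.
  by rewrite ler_pdivrMr ?weight_gt0// mulrC.
have eu : eigen eta (unroll d) := eigen_unroll (flow_cut w F).
have := ext _ (eigen_harmonic eu).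
have dom' k u : 0 <= eta ^+ k * unroll d u <= eta ^+ k * h u.
  have /andP[u0 u1] := unroll_le H h0 dom u.
  by rewrite mulr_ge0 ?exprn_ge0//= ler_wpM2l ?exprn_ge0.
move=> /(_ dom') E.
have {}E u : unroll d u = mass h w * h u.
  have := E 0%N u; rewrite !mul1r => ->; congr (_ * _).
  rewrite unrollE /at_parent eqxx mulr0 addr0 /d /cut descends_root.
  rewrite divr1; case: ifP => // wr; congr (mass h _); apply/esym.
  by apply: (descends_depth_eq wr); have := descends_depth wr;
    rewrite leqn0 => /eqP.
have := defect_unroll d v; rewrite /d /cut (negbTE wv) (negbTE vw) mul0r.
rewrite /defect E (_ : at_parent _ _ = mass h w * at_parent h v); last first.
  by rewrite /at_parent; case: ifP; rewrite ?mulr0.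
move=> E'; rewrite {1}/mass -mulrA mulrC [defect h v * _]mulrC.
rewrite [X in X * _](_ : _ = 0) ?mul0r// -[RHS]E' /defect; ring.
Qed.

(** The default value is never taken if [M] is a nonnegative flow with
    [0 < M v]. *)
Definition heavy_child (M : FT -> R) (v : FT) : FT :=
  head (child2 v) [seq c <- children v | 0 < M c].

Lemma heavy_child_child M v : heavy_child M v \in children v.
Proof.
rewrite /heavy_child; case E : [seq c <- children v | 0 < M c] => [|c s] /=.
  exact: child2_children.
have : c \in [seq c <- children v | 0 < M c] by rewrite E inE eqxx.
by rewrite mem_filter => /andP[].
Qed.

Definition heavy_ray (M : FT -> R) : FTend.
Proof.
exists (fun i => iter i (heavy_child M) ft_root) => [//|i].
by rewrite is_childP; exact: heavy_child_child.
Defined.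

Lemma heavy_ray_gt0 M i : (forall u, 0 <= M u) -> flow M -> 0 < M ft_root ->
  0 < M (heavy_ray M i).
Proof.
move=> M0 F Mr; elim: i => [//|i /=]; set v := iter i _ _; rewrite F => Mv.
rewrite /heavy_child; case E : [seq c <- children v | 0 < M c] => [|c s] /=;
  last first.
  have : c \in [seq c <- children v | 0 < M c] by rewrite E inE eqxx.
  by rewrite mem_filter => /andP[].
move: Mv; rewrite big_seq big1 ?ltxx// => c cv.
apply/eqP; rewrite eq_le M0 andbT leNgt; apply/negP => Mc.
have : c \in [seq c <- children v | 0 < M c] by rewrite mem_filter Mc.
by rewrite E.
Qed.

(** The vertices with positive mass form a chain, and each has a child with
    positive mass: they are the vertices of a ray, off which the defect
    vanishes. *)
Lemma extremal_off_ray h : eigen eta h -> (forall u, 0 <= h u) ->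
  h ft_root = 1 -> extremal (fun k v => eta ^+ k * h v) ->
  exists t, off_ray eta t h.
Proof.
move=> H h0 hr ext; have F := flow_mass H.
have M0 u : 0 <= mass h u by exact: mass_ge0.
exists (heavy_ray (mass h)) => v c cv; set t := heavy_ray _ => ct.
have Mt : 0 < mass h (t (ft_depth c)).
  by apply: heavy_ray_gt0 => //; rewrite mass_root hr.
have : mass h c * mass h (t (ft_depth c)) = 0.
  apply: extremal_mass => //; apply: contra ct => D; apply/eqP.
    by rewrite [LHS](descends_depth_eq D)// ft_depth_end.
  by rewrite [RHS](descends_depth_eq D)// ft_depth_end.
move/eqP; rewrite mulf_eq0 (gt_eqF Mt) orbF mulf_eq0 (gt_eqF (weight_gt0 c)) /=.
by rewrite /defect (at_parent_child _ cv) subr_eq0 => /eqP.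
Qed.

End boundary.

(** The shift [phi k.+1] is harmonic and below [phi], hence a multiple of
    it. *)
Lemma extremal_product phi : harmonic phi -> nonneg phi ->
  phi 0%N ft_root = 1 -> extremal phi -> exists (t : FTend) (eta : R) h,
  [/\ 0 <= eta <= 4 / 27, eigen eta h, off_ray eta t h &
   forall k v, phi k v = eta ^+ k * h v].
Proof.
move=> H p0 pr ext; pose eta := phi 1%N ft_root; pose h := phi 0%N.
have shift k v : phi k.+1 v = eta * phi k v.
  apply: (ext (fun k => phi k.+1)); first exact: harmonic_shift.
  by move=> i u; rewrite p0 harmonicS_le.
have pE k v : phi k v = eta ^+ k * h v.
  by elim: k => [|k IHk]; rewrite ?mul1r// shift IHk exprS mulrA.
have eta0 : 0 <= eta by exact: p0.
have h0 v : 0 <= h v by exact: p0.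
have eig : eigen eta h.
  move=> v; rewrite {1}/h H; congr (_ + _).
  by rewrite /at_parent; case: ifP; rewrite ?mulr0.
have eta1 : eta <= 4 / 27 by apply: (eigen_eta_le eta0 eig h0);
  rewrite /h pr ltr01.
have [|t off] := extremal_off_ray eta0 eta1 eig h0 pr.
  by move: ext; congr extremal; apply/funext => k; apply/funext => v.
by exists t, eta, h; split => //; apply/andP.
Qed.

End extremal.

(** * Coordinates on the pascalized tree *)

Lemma pv_subproof k v :
  (ft_depth v <= ft_depth v + 2 * k)%N &&
  (ft_depth v + 2 * k == ft_depth v %[mod 2])%N.
Proof. by rewrite leq_addr addnC mulnC modnMDl eqxx. Qed.

Definition pv (k : nat) (v : FT) : PFT :=
  @PVertex ((ft_depth v + 2 * k)%N, v) (pv_subproof k v).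

Definition pk (x : PFT) : nat := (plevel x - ft_depth (pbase x))./2.

Lemma pk_pv k v : pk (pv k v) = k.
Proof. by rewrite /pk /plevel /pbase /= addKn mul2n doubleK. Qed.

Lemma pv_pk x : pv (pk x) (pbase x) = x.
Proof.
apply/val_inj; have /andP[] := pval_ok x; case: (x) => -[n v] ok /= vn /eqP md.
rewrite /pk /plevel /pbase /=; congr (_, _).
have : (2 %| n - ft_depth v)%N by rewrite -(eqn_mod_dvd _ vn) md.
rewrite dvdn2 mul2n => nv.
by have := odd_double_half (n - ft_depth v); rewrite (negbTE nv) add0n => ->;
  rewrite subnKC.
Qed.

Lemma proot_pv : proot = pv 0 ft_root. Proof. exact/val_inj. Qed.

Definition pnext (x : PFT) : seq PFT :=
  [seq pv (pk x) c | c <- children (pbase x)] ++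
  (if pbase x == ft_root then [::]
   else [:: pv (pk x).+1 (ft_parent (pbase x))]).

Lemma plevel_pv k v : plevel (pv k v) = (ft_depth v + 2 * k)%N.
Proof. by []. Qed.

Lemma plevelE x : plevel x = (ft_depth (pbase x) + 2 * pk x)%N.
Proof. by rewrite -{1}(pv_pk x). Qed.

Lemma ft_depth_parent v : v != ft_root ->
  ft_depth v = (ft_depth (ft_parent v)).+1.
Proof. by move=> v0; rewrite -(ft_depth_child (children_parent v0)). Qed.

Lemma pv_inj k v k' v' : pv k v = pv k' v' -> k = k' /\ v = v'.
Proof.
by move=> E; have := congr1 pk E; rewrite !pk_pv; have := congr1 pbase E.
Qed.

Lemma padjE x y : padj x y = (y \in pnext x).
Proof.
rewrite /padj /ft_adj !is_childP /pnext mem_cat.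
apply/idP/idP.
  move=> /andP[/eqP lev] /orP[yx|xy]; apply/orP; [left|right].
    apply/mapP; exists (pbase y) => //.
    rewrite -[LHS]pv_pk; congr (pv _ _); move: lev.
    by rewrite !plevelE (ft_depth_child yx); lia.
  have x0 := children_neq_root xy; rewrite (negbTE x0) inE.
  rewrite (parent_children xy).
  apply/eqP; rewrite -[LHS]pv_pk; congr (pv _ _); move: lev.
  by rewrite !plevelE (ft_depth_child xy); lia.
case/orP.
  case/mapP => c cx ->; rewrite (plevelE x) plevel_pv (ft_depth_child cx).
  by rewrite [pbase (pv _ _)]/pbase /= cx andbT; apply/eqP; lia.
case: ifPn => // x0; rewrite inE => /eqP ->; rewrite (plevelE x) plevel_pv.
rewrite (ft_depth_parent x0) [pbase (pv _ _)]/pbase /= (children_parent x0).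
by rewrite orbT andbT; apply/eqP; lia.
Qed.

Lemma pnext_neq_nil x : pnext x != [::].
Proof. by rewrite /pnext /children; case: ifP. Qed.

Lemma uniq_pnext x : uniq (pnext x).
Proof.
rewrite /pnext cat_uniq map_inj_uniq ?uniq_children;
  last by move=> u v /pv_inj[].
case: ifPn => //= x0; rewrite orbF andbT; apply/negP => /mapP[c _ /pv_inj[]].
lia.
Qed.

Definition pfun (R : Type) (phi : nat -> FT -> R) (x : PFT) : R :=
  phi (pk x) (pbase x).

Lemma pfun_pv (R : Type) (phi : nat -> FT -> R) k v :
  pfun phi (pv k v) = phi k v.
Proof. by rewrite /pfun pk_pv. Qed.

Lemma sum_pnext (R : nmodType) (phi : nat -> FT -> R) x :
  \sum_(y <- pnext x) pfun phi y =
  \sum_(c <- children (pbase x)) phi (pk x) c +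
  (if pbase x == ft_root then 0 else phi (pk x).+1 (ft_parent (pbase x))).
Proof.
rewrite /pnext big_cat big_map; congr (_ + _).
  by apply: eq_bigr => c _; rewrite pfun_pv.
by case: ifP; rewrite ?big_nil ?big_seq1 ?pfun_pv.
Qed.

Lemma harmonic_pfun (R : realType) (phi : nat -> FT -> R) :
  harmonic phi <-> forall x, pfun phi x = \sum_(y <- pnext x) pfun phi y.
Proof.
split=> H; first by move=> x; rewrite sum_pnext; exact: H.
by move=> k v; have := H (pv k v); rewrite sum_pnext pfun_pv pk_pv.
Qed.

Lemma path_to (x : PFT) : exists2 s, path padj proot s & last proot s = x.
Proof.
have step y z : (exists2 s, path padj proot s & last proot s = y) -> padj y z ->
    exists2 s, path padj proot s & last proot s = z.
  move=> [s ps sy] yz; exists (rcons s z); last by rewrite last_rcons.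
  by rewrite rcons_path ps sy.
rewrite -(pv_pk x); move: (pk x) (pbase x) => k v.
elim/FT_ind: v => [|v c cv]; last first.
  move/step; apply; rewrite padjE /pnext mem_cat; apply/orP; left.
  by apply/mapP; exists c; rewrite ?pk_pv.
elim: k => [|k IHk]; first by exists [::] => //; rewrite proot_pv.
have ca : vertex_a \in children ft_root by rewrite -is_childP.
apply: (@step (pv k vertex_a)).
  apply: step IHk _; rewrite padjE /pnext mem_cat; apply/orP; left.
  by apply/mapP; exists vertex_a; rewrite ?pk_pv.
rewrite padjE /pnext mem_cat; apply/orP; right.
by rewrite mem_seq1 pk_pv (parent_children ca).
Qed.

Lemma plevel_path s : path padj proot s -> plevel (last proot s) = size s.
Proof.
elim/last_ind: s => [//|s x IHs]; rewrite rcons_path last_rcons size_rcons.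
by move=> /andP[/IHs <- /andP[/eqP]].
Qed.

(** * Cylinders *)

Definition start (w : ppath) (n : nat) : seq PFT := mkseq (fun i => w i.+1) n.

Lemma size_start w n : size (start w n) = n.
Proof. exact: size_mkseq. Qed.

Lemma startS w n : start w n.+1 = rcons (start w n) (w n.+1).
Proof. by rewrite /start mkseqS. Qed.

Lemma last_start w n : last proot (start w n) = w n.
Proof. by case: n => [|n]; rewrite ?startS ?last_rcons ?pvert0. Qed.

Lemma path_start w n : path padj proot (start w n).
Proof.
elim: n => [//|n IHn]; rewrite startS rcons_path IHn last_start; exact: pvertS.
Qed.

Lemma nth_start w n i : (i <= n)%N -> nth proot (proot :: start w n) i = w i.
Proof. by case: i => [|i] ni; rewrite ?pvert0//= nth_mkseq. Qed.

Lemma take_start w n m : (m <= n)%N -> take m (start w n) = start w m.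
Proof.
move=> mn; apply: (@eq_from_nth _ proot);
  rewrite size_takel ?size_start// => i im.
by rewrite nth_take// !nth_mkseq// (leq_trans im).
Qed.

Lemma cylinderE s : cylinder s = [set w : Omega | start w (size s) = s].
Proof. by []. Qed.

Lemma cylinder_start (w : Omega) n : cylinder (start w n) w.
Proof. by rewrite cylinderE /= size_start. Qed.

Lemma cylinder_nil : cylinder [::] = setT.
Proof. by apply/seteqP; split. Qed.

Lemma cylinder_path s w : cylinder s w -> path padj proot s.
Proof. by rewrite cylinderE /= => <-; exact: path_start. Qed.

Lemma cylinder_last s (w : Omega) : cylinder s w ->
  (w : ppath) (size s) = last proot s.
Proof. by rewrite cylinderE /= => E; rewrite -{2}E last_start. Qed.

Lemma cylinder_rcons s y :
  cylinder (rcons s y) =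
  cylinder s `&` [set w : Omega | (w : ppath) (size s).+1 = y].
Proof.
apply/seteqP; split=> w; rewrite !cylinderE /= size_rcons startS.
  by move=> /rcons_inj[].
by move=> [-> ->].
Qed.

Lemma measurable_coord (n : nat) (B : set PFT) :
  measurable [set w : Omega | B ((w : ppath) n)].
Proof. by apply: sub_sigma_algebra; exists n, B. Qed.

Lemma measurable_cylinder s : measurable (cylinder s : set Omega).
Proof.
elim/last_ind: s => [|s y IHs]; first by rewrite cylinder_nil.
rewrite cylinder_rcons; apply: measurableI => //.
exact: (@measurable_coord (size s).+1 (eq^~ y)).
Qed.

Lemma cylinderI s u : (size s <= size u)%N ->
  cylinder s `&` cylinder u = if take (size s) u == s then cylinder u else set0.
Proof.
move=> su; apply/seteqP; split=> w; last first.
  case: eqP => // E; rewrite !cylinderE /= => wu; split=> //.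
  by rewrite -[RHS]E -[X in take _ X]wu take_start.
rewrite !cylinderE /= => -[ws wu].
by rewrite -{1}wu take_start// ws eqxx.
Qed.

Definition cylinders : set (set Omega) :=
  [set A | A = set0 \/ exists s, A = cylinder s].

Lemma cylinders_setI_closed : setI_closed cylinders.
Proof.
move=> A B [->|[s ->]]; first by rewrite set0I; left.
move=> [->|[u ->]]; first by rewrite setI0; left.
wlog su : s u / (size s <= size u)%N.
  move=> H; have [|/ltnW] := leqP (size s) (size u); first exact: H.
  by rewrite setIC; exact: H.
by rewrite cylinderI//; case: ifP; [right; exists u|left].
Qed.

Lemma measurable_cylinders : @measurable _ Omega = <<s cylinders >>.
Proof.
apply/seteqP; split.
  apply: smallest_sub; first exact: smallest_sigma_algebra.
  move=> _ [n [B ->]].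
  rewrite (_ : [set w : Omega | _] = \bigcup_(s in
    [set s | size s = n /\ B (last proot s)]) cylinder s); last first.
    apply/seteqP; split=> w /=.
      move=> Bw; exists (start w n); last exact: cylinder_start.
      by rewrite /= size_start last_start.
    by move=> [s [/= <- Bs] /cylinder_last ->].
  rewrite bigcup_mkcond.
  apply: (@countable_bigcupT_measurable _ (g_sigma_algebraType cylinders)) =>
    // s.
  case: ifP => _; last exact: measurable0.
  by apply: sub_sigma_algebra; right; exists s.
apply: smallest_sub; first exact: sigma_algebra_measurable.
by move=> _ [->|[s ->]]; [exact: measurable0|exact: measurable_cylinder].
Qed.

Section cylinder_measures.
Context {R : realType}.
Local Open Scope ereal_scope.

Lemma cylinder_unique (m1 m2 : {measure set Omega -> \bar R}) :
  m1 setT < +oo ->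
  (forall s, path padj proot s -> m1 (cylinder s) = m2 (cylinder s)) ->
  forall A, measurable A -> m1 A = m2 A.
Proof.
move=> fin H; apply: (measure_unique cylinders (fun=> setT)).
- exact: measurable_cylinders.
- exact: cylinders_setI_closed.
- by move=> _; right; exists [::]; rewrite cylinder_nil.
- by apply: bigcup_const; exists 0%N.
- move=> _ [->|[s ->]]; first by rewrite !measure0.
  have [ps|ps] := boolP (path padj proot s); first exact: H.
  rewrite (_ : cylinder s = set0) ?measure0//.
  by apply/seteqP; split=> // w /cylinder_path; rewrite (negbTE ps).
- by [].
Qed.

Lemma measure_cylinder_rcons (m : {measure set Omega -> \bar R}) s :
  path padj proot s ->
  m (cylinder s) = \sum_(y <- pnext (last proot s)) m (cylinder (rcons s y)).
Proof.
move=> ps; set x := last proot s.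
have H (r : seq PFT) : uniq r ->
    m (cylinder s `&` [set w : Omega | (w : ppath) (size s).+1 \in r]) =
    \sum_(y <- r) m (cylinder (rcons s y)).
  elim: r => [_|y r IHr /= /andP[yr ur]].
    rewrite big_nil (_ : _ `&` _ = set0) ?measure0//.
    by apply/seteqP; split=> // w [].
  rewrite big_cons -IHr// -measureU//.
  - congr (m _); rewrite cylinder_rcons -setIUr; congr (_ `&` _).
    by apply/seteqP; split=> w /=; rewrite in_cons => /predU1P.
  - exact: measurable_cylinder.
  - apply: measurableI; first exact: measurable_cylinder.
    exact: (@measurable_coord (size s).+1 (fun z => z \in r)).
  - apply/seteqP; split=> // w; rewrite cylinder_rcons => -[[_ /= ->] [_ /=]].
    by rewrite (negbTE yr).
rewrite -H ?uniq_pnext//; congr (m _); apply/seteqP; split=> [w ws|w []//].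
split=> //=; rewrite -padjE /x -(cylinder_last ws); exact: pvertS.
Qed.

End cylinder_measures.

(** * Central measures and harmonic functions *)

Section central_function.
Context {R : realType}.
Local Open Scope ereal_scope.

(** [central] for measures that need not be probabilities, such as
    restrictions. *)
Definition central_measure (m : {measure set Omega -> \bar R}) := forall s s',
  path padj proot s -> path padj proot s' -> last proot s = last proot s' ->
  m (cylinder s) = m (cylinder s').

(** For a central measure, the measure of any one path to [pv k v]. *)
Definition cyl_fun (m : set Omega -> \bar R) (k : nat) (v : FT) : R :=
  fine (m (cylinder (s2val (cid2 (path_to (pv k v)))))).

Section finite.
Variable m : {measure set Omega -> \bar R}.
Hypotheses (fin : m setT < +oo) (cen : central_measure m).

Lemma cyl_fin_num s : m (cylinder s) \is a fin_num.
Proof.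
rewrite ge0_fin_numE ?measure_ge0//; apply: le_lt_trans fin.
by apply: le_measure; rewrite ?inE//; exact: measurable_cylinder.
Qed.

Lemma cyl_funE s : path padj proot s ->
  m (cylinder s) = (pfun (cyl_fun m) (last proot s))%:E.
Proof.
move=> ps; rewrite /pfun /cyl_fun pv_pk fineK ?cyl_fin_num//.
by case: cid2 => s' /= ps' ss'; exact: cen.
Qed.

Lemma harmonic_cyl_fun : harmonic (cyl_fun m).
Proof.
apply/harmonic_pfun => x; have [s ps <-] := path_to x; apply: EFin_inj.
rewrite -cyl_funE// measure_cylinder_rcons// -sumEFin.
rewrite big_seq [RHS]big_seq; apply: eq_bigr => y; rewrite -padjE => xy.
by rewrite cyl_funE ?last_rcons// rcons_path ps.
Qed.

Lemma cyl_fun_ge0 : nonneg (cyl_fun m).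
Proof. by move=> k v; rewrite fine_ge0. Qed.

Lemma cyl_fun_root : (cyl_fun m 0%N ft_root)%:E = m setT.
Proof.
by rewrite -cylinder_nil cyl_funE//= /pfun [in RHS]proot_pv pk_pv.
Qed.

End finite.

Lemma central_measureP (nu : probability Omega R) :
  central nu <-> central_measure nu.
Proof.
split=> H; first by move=> s s' ps ps' ss'; apply: (H (last proot s')).
by move=> v s s' ps <- ps' ss'; exact: H.
Qed.

Lemma pfun_central (m : {measure set Omega -> \bar R}) phi :
  (forall s, path padj proot s ->
    m (cylinder s) = (pfun phi (last proot s))%:E) ->
  central_measure m.
Proof. by move=> H s s' ps ps' ss'; rewrite !H// ss'. Qed.

Lemma probability_fin (nu : probability Omega R) : nu setT < +oo.
Proof. by rewrite probability_setT ltry. Qed.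

End central_function.

(** * Exchanging the beginnings of paths *)

Definition replace_vert (s : seq PFT) (w : ppath) (i : nat) : PFT :=
  if (i <= size s)%N then nth proot (proot :: s) i else w i.

Section replace.
Variables (s : seq PFT) (w : ppath).
Hypothesis sw : path padj proot s /\ w (size s) = last proot s.

Lemma replace_vert0 : replace_vert s w 0 = proot.
Proof. by []. Qed.

Lemma replace_vertS i : padj (replace_vert s w i) (replace_vert s w i.+1).
Proof.
have [ps ws] := sw; rewrite /replace_vert.
have [si|si|->] := ltngtP i (size s).
- by move/(pathP proot) : ps => /(_ _ si).
- exact: pvertS.
- by rewrite -[X in nth _ _ X]/(size (proot :: s)).-1 nth_last /= -ws;
  exact: pvertS.
Qed.

Definition replace_path : ppath := PPath replace_vert0 replace_vertS.

End replace.

Definition replace (s : seq PFT) (w : Omega) : Omega :=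
  if pselect (path padj proot s /\ (w : ppath) (size s) = last proot s)
    is left sw then replace_path sw else w.

Lemma ppath_ext (w w' : ppath) : (forall i, w i = w' i) -> w = w'.
Proof.
case: w w' => f f0 fS [g g0 gS] /= fg.
have {}fg : f = g by apply/funext.
by case: g / fg in g0 gS *; congr PPath; exact: Prop_irrelevance.
Qed.

Lemma replaceE s (w : Omega) i : path padj proot s ->
  (w : ppath) (size s) = last proot s ->
  (replace s w : ppath) i = replace_vert s w i.
Proof. by move=> ps ws; rewrite /replace; case: pselect => // -[]. Qed.

Lemma replace_id s (w : Omega) : (w : ppath) (size s) <> last proot s ->
  replace s w = w.
Proof. by move=> ws; rewrite /replace; case: pselect => // -[]. Qed.

Lemma start_replace s (w : Omega) n : path padj proot s ->
  (w : ppath) (size s) = last proot s -> (size s <= n)%N ->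
  start (replace s w) n = s ++ drop (size s) (start w n).
Proof.
move=> ps ws sn; apply: (@eq_from_nth _ proot).
  by rewrite size_cat size_drop !size_start subnKC.
move=> i; rewrite size_start => ni;
  rewrite nth_mkseq// replaceE// /replace_vert nth_cat.
case: ifPn => // si; rewrite nth_drop nth_mkseq.
  by congr (_ _); rewrite subnKC// leqNgt.
by rewrite subnKC// leqNgt.
Qed.

Lemma measurable_replace s : measurable_fun setT (replace s).
Proof.
apply: (@measurability _ _ Omega Omega setT (replace s) coord_events erefl).
move=> _ [_ [i [B ->]] <-]; rewrite setTI.
have [ps|ps] := boolP (path padj proot s); last first.
  rewrite (_ : _ @^-1` _ = [set w : Omega | B ((w : ppath) i)]); last first.
    apply/seteqP; split=> w /=; rewrite /replace; case: pselect => //= -[];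
    by rewrite (negbTE ps).
  exact: measurable_coord.
pose E : set Omega := [set w | (w : ppath) (size s) = last proot s].
have mE : measurable E := @measurable_coord (size s) (eq^~ (last proot s)).
pose C : set Omega := [set w : Omega | B (replace_vert s w i)].
have mC : measurable C.
  rewrite /C /replace_vert; case: (i <= size s)%N; last exact: measurable_coord.
  exact: (@measurable_coord 0%N (fun=> B (nth proot (proot :: s) i))).
rewrite [X in measurable X](_ : _ =
  (E `&` C) `|` (~` E `&` [set w : Omega | B ((w : ppath) i)])).
  apply: measurableU; first exact: measurableI.
  by apply: measurableI; [exact: measurableC|exact: measurable_coord].
apply/seteqP; split=> w /=.
  have [Ew|Ew] := pselect (E w); first by rewrite replaceE//; left.
  by rewrite replace_id//; right.
by case=> -[Ew]; [rewrite /C /= -replaceE|rewrite replace_id].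
Qed.

Lemma tail_equivP (w w' : ppath) :
  tail_equiv w w' <-> exists N, forall n, (N <= n)%N -> w n = w' n.
Proof.
split=> [/finite_seqP[F FE]|[N HN]].
  exists (\max_(i <- F) i.+1)%N => n Nn; apply: contrapT => ww'.
  have : [set n | path_step w n <> path_step w' n] n by move=> [].
  rewrite FE /= => nF; move: Nn; rewrite leqNgt => /negP; apply.
  by rewrite (big_rem n nF) leq_max ltnSn.
apply: (@sub_finite_set _ _ `I_N); last exact: finite_II.
move=> n /= ww'; rewrite ltnNge; apply/negP => Nn; apply: ww'.
by rewrite /path_step !HN// (leq_trans Nn).
Qed.

Lemma tail_equiv_sym w w' : tail_equiv w w' -> tail_equiv w' w.
Proof.
by move=> /tail_equivP[N HN]; apply/tail_equivP; exists N => n /HN.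
Qed.

Lemma tail_equiv_trans w1 w2 w3 :
  tail_equiv w1 w2 -> tail_equiv w2 w3 -> tail_equiv w1 w3.
Proof.
move=> /tail_equivP[N HN] /tail_equivP[M HM]; apply/tail_equivP.
exists (maxn N M) => n; rewrite geq_max => /andP[nN nM].
by rewrite HN// HM.
Qed.

Lemma tail_equiv_replace s (w : Omega) : tail_equiv (replace s w) w.
Proof.
rewrite /replace; case: pselect => [[ps ws]|_]; apply/tail_equivP;
  last by exists 0%N.
by exists (size s).+1 => n sn; rewrite /= /replace_vert leqNgt sn.
Qed.

Definition exchangeable (s s' : seq PFT) : Prop :=
  [/\ path padj proot s, path padj proot s' & last proot s = last proot s'].

Lemma exchangeable_sym s s' : exchangeable s s' -> exchangeable s' s.
Proof. by case. Qed.

Lemma exchangeable_size s s' : exchangeable s s' -> size s = size s'.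
Proof. by case=> /plevel_path <- /plevel_path <- ->. Qed.

Lemma cylinder_exchangeable s s' (w : Omega) :
  exchangeable s s' -> cylinder s w -> (w : ppath) (size s') = last proot s'.
Proof.
by move=> ss' /cylinder_last; rewrite -(exchangeable_size ss') => ->; case: ss'.
Qed.

Lemma cylinder_replace s s' (w : Omega) : exchangeable s s' ->
  cylinder s w -> cylinder s' (replace s' w).
Proof.
move=> ss' ws; have [ps ps' _] := ss'.
have ws' := cylinder_exchangeable ss' ws.
rewrite cylinderE /= start_replace// drop_oversize ?cats0//.
by rewrite size_start.
Qed.

Lemma replaceK s s' (w : Omega) : exchangeable s s' -> cylinder s w ->
  replace s (replace s' w) = w.
Proof.
move=> ss' ws; have [ps ps' _] := ss'.
have ws' := cylinder_exchangeable ss' ws.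
have rw := cylinder_replace ss' ws.
have rw' := cylinder_exchangeable (exchangeable_sym ss') rw.
apply: ppath_ext => i; rewrite replaceE// /replace_vert; case: ifPn => si.
  by move: ws; rewrite cylinderE /= => E; rewrite -[X in proot :: X]E nth_start.
by rewrite replaceE// /replace_vert -(exchangeable_size ss') (negbTE si).
Qed.

Lemma tail_equiv_exchange (w w' : Omega) : tail_equiv w w' ->
  exists s s', [/\ exchangeable s s', cylinder s w & replace s' w = w'].
Proof.
move=> /tail_equivP[N HN].
have lastE : last proot (start w N) = last proot (start w' N).
  by rewrite !last_start HN.
exists (start w N), (start w' N); split.
- by split=> //; exact: path_start.
- exact: cylinder_start.
- apply: ppath_ext => i; rewrite replaceE; last first.
  - by rewrite size_start last_start HN.
  - exact: path_start.
  rewrite /replace_vert size_start; case: ifPn => iN;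
    first by rewrite nth_start.
  by rewrite HN// ltnW// ltnNge.
Qed.

Section exchange_invariance.
Context {R : realType}.
Local Open Scope ereal_scope.

Lemma pushforward_exists d d' (T : measurableType d) (T' : measurableType d')
    (m : {measure set T -> \bar R}) (f : T -> T') : measurable_fun setT f ->
  exists m' : {measure set T' -> \bar R}, forall A, m' A = m (f @^-1` A).
Proof.
by move=> mf; unshelve eexists (pushforward m f : {measure set T' -> \bar R}).
Qed.

Variable m : {measure set Omega -> \bar R}.
Hypotheses (fin : m setT < +oo) (cen : central_measure m).

(** Exchanging two beginnings with the same end point maps cylinders to
    cylinders of the same measure. *)
Lemma exchange_invariance s s' : exchangeable s s' ->
  forall B, measurable B ->
    m (cylinder s `&` replace s' @^-1` B) = m (cylinder s' `&` B).
Proof.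
move=> ss' B mB; have [ps ps' lss'] := ss'; have sz := exchangeable_size ss'.
have [m1 m1E] := pushforward_exists (mrestr m (measurable_cylinder s))
  (measurable_replace s').
have m2E A : mrestr m (measurable_cylinder s') A = m (A `&` cylinder s') by [].
rewrite setIC -[LHS]m1E setIC -m2E.
apply: cylinder_unique mB => [|u pu].
  rewrite m1E /= /mrestr preimage_setT setTI; apply: le_lt_trans fin.
  by apply: le_measure; rewrite ?inE//; exact: measurable_cylinder.
rewrite m1E /= /mrestr.
have [us|su] := leqP (size u) (size s').
  rewrite cylinderI//.
  rewrite (_ : _ `&` _ = if take (size u) s' == u then cylinder s else set0).
    by case: ifP; rewrite ?measure0// => _; exact: cen.
  apply/seteqP; split=> w.
    move=> -[/= wu ws]; have := cylinder_replace ss' ws.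
    rewrite cylinderE /= => E; move: wu.
    rewrite cylinderE /= -(take_start _ us) E => ->.
    by rewrite eqxx.
  case: eqP => // E ws; split=> //=; have := cylinder_replace ss' ws.
  by rewrite !cylinderE /= => E'; rewrite -(take_start _ us) E'.
rewrite [in RHS]setIC cylinderI; last exact: ltnW.
rewrite (_ : _ `&` _ = if take (size s') u == s'
  then cylinder (s ++ drop (size s') u) else set0).
  case: eqP; rewrite ?measure0// => E; apply: cen => //.
    move: pu; rewrite -{1}(cat_take_drop (size s') u) E !cat_path => /andP[_].
    by rewrite ps lss'.
  by rewrite -[in RHS](cat_take_drop (size s') u) E !last_cat lss'.
have szu : size (s ++ drop (size s') u) = size u.
  by rewrite size_cat size_drop sz subnKC// ltnW.
apply/seteqP; split=> w.
  move=> -[/= wu ws]; have ws' := cylinder_exchangeable ss' ws.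
  move: wu; rewrite cylinderE /= start_replace//; last exact: ltnW.
  move=> E; rewrite -[in X in if X then _ else _]E take_size_cat// eqxx.
  rewrite cylinderE /= szu -[in RHS]E drop_size_cat//.
  rewrite -[LHS](cat_take_drop (size s')); congr (_ ++ _).
  by move: ws; rewrite cylinderE /= take_start ?sz// ltnW.
case: eqP => // E; rewrite cylinderE /= szu => wE.
have ws : cylinder s w.
  by rewrite cylinderE /= -(take_start _ (_ : size s <= size u)%N) ?sz ?wE
    ?(ltnW su)// -sz take_size_cat.
split=> //=; have ws' := cylinder_exchangeable ss' ws.
rewrite cylinderE /= start_replace//; last exact: ltnW.
by rewrite wE -{1}sz drop_size_cat// -[in RHS](cat_take_drop (size s') u) E.
Qed.

End exchange_invariance.

(** * Existence of a central measure with given cylinder probabilities *)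

Section realization.
Context {R : realType}.
Variable phi : nat -> FT -> R.
Hypotheses (harm : harmonic phi) (phi0 : nonneg phi).
Hypothesis phi1 : phi 0%N ft_root = 1.
Let f := pfun phi.

Let f_ge0 x : 0 <= f x. Proof. exact: phi0. Qed.

Let f_next x : f x = \sum_(y <- pnext x) f y.
Proof. by have /harmonic_pfun := harm. Qed.

Let f_root : f proot = 1.
Proof. by rewrite /f proot_pv pfun_pv. Qed.

(** Cuts the interval that starts at [a] into consecutive pieces of lengths
    [f y], for [y] in [l], and returns the piece that contains [u] with its
    left end; [x] is a default value. *)
Fixpoint locate (u a : R) (x : PFT) (l : seq PFT) : PFT * R :=
  if l is y :: l' then
    if u < a + f y then (y, a) else locate u (a + f y) x l'
  else (x, a).

Lemma locate_mem u a x l : (locate u a x l).1 \in x :: l.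
Proof.
elim: l a => [|y l IHl] a /=; first by rewrite inE.
case: ifP => _ /=; first by rewrite !inE eqxx orbT.
by have := IHl (a + f y); rewrite !inE => /orP[->//|->]; rewrite !orbT.
Qed.

Lemma locate_in u a x l : a <= u < a + \sum_(y <- l) f y ->
  (locate u a x l).1 \in l.
Proof.
elim: l a => [|y l IHl] a /=;
  first by rewrite big_nil addr0 => /andP[/le_lt_trans/[apply]]; rewrite ltxx.
rewrite big_cons addrA => /andP[au ul].
case: ltP => uy /=; first by rewrite inE eqxx.
by rewrite inE IHl ?orbT// uy.
Qed.

Lemma locateP a x l y : uniq l -> y \in l -> exists b : R,
  [/\ a <= b, b + f y <= a + \sum_(z <- l) f z &
   forall u, a <= u < a + \sum_(z <- l) f z ->
     ((locate u a x l).1 = y <-> b <= u < b + f y) /\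
     ((locate u a x l).1 = y -> (locate u a x l).2 = b)].
Proof.
elim: l a => [//|z l IHl] a /= /andP[zl ul]; rewrite inE big_cons.
have [-> _|yz /= yl] := eqVneq y z.
  exists a; split => //; first by rewrite addrA lerDl sumr_ge0.
  move=> u /andP[au]; rewrite addrA => uz; case: ltP => uy /=.
    by rewrite au; split; [split|].
  have lin : (locate u (a + f z) x l).1 \in l by apply: locate_in; rewrite uy.
  by split=> [|lz]; [rewrite andbF; split=> // lz|]; move: zl; rewrite -lz lin.
have [b [ab bS H]] := IHl (a + f z) ul yl.
exists b; split; first by rewrite (le_trans _ ab)// lerDl.
  by rewrite addrA.
move=> u /andP[au]; rewrite addrA => uz; case: ltP => uy /=; last by apply: H;
  rewrite uy.
split=> [|zy]; last by rewrite zy eqxx in yz.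
split=> [zy|/andP[bu _]]; first by rewrite zy eqxx in yz.
by have := lt_le_trans uy (le_trans ab bu); rewrite ltxx.
Qed.

(** The interval of the current finite path, of length [f] at its last vertex,
    is subdivided among the next vertices; [u] selects one of them. *)
Fixpoint walk (u : R) (n : nat) : PFT * R :=
  if n is n'.+1 then let: (x, a) := walk u n' in
    locate u a (head x (pnext x)) (pnext x)
  else (proot, 0).

Lemma walk_padj u n : padj (walk u n).1 (walk u n.+1).1.
Proof.
rewrite padjE /=; case: (walk u n) => x a /=.
have := locate_mem u a (head x (pnext x)) (pnext x);
  rewrite inE => /orP[/eqP ->|//].
by case: (pnext x) (pnext_neq_nil x) => //= y l _; rewrite inE eqxx.
Qed.

Definition walk_path (u : R) : ppath :=
  @PPath (fun n => (walk u n).1) erefl (walk_padj u).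

Lemma walk_cylinder s : path padj proot s -> exists L : R,
  [/\ 0 <= L, L + f (last proot s) <= 1 &
   forall u, 0 <= u < 1 ->
     (start (walk_path u) (size s) = s <-> L <= u < L + f (last proot s)) /\
     (start (walk_path u) (size s) = s -> (walk u (size s)).2 = L)].
Proof.
elim/last_ind: s => [_|s y IHs].
  by exists 0; rewrite /= f_root add0r lexx; split => // u u01; split.
rewrite rcons_path last_rcons size_rcons => /andP[/IHs{IHs}[L [L0 L1 H]]].
set x := last proot s in L1 H *; rewrite padjE => xy.
have [b [Lb bS HL]] := locateP L (head x (pnext x)) (uniq_pnext x) xy.
exists b; split; first exact: le_trans L0 Lb.
  by rewrite (le_trans bS)// -f_next.
move=> u u01; have [H1 H2] := H u u01.
have key : start (walk_path u) (size s) = s ->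
    walk u (size s).+1 = locate u L (head x (pnext x)) (pnext x).
  move=> E /=; have := H2 E; have := last_start (walk_path u) (size s).
  by rewrite E /= -/x; case: (walk u (size s)) => _ _ /= <- ->.
have inL : start (walk_path u) (size s) = s ->
  L <= u < L + \sum_(z <- pnext x) f z.
  by move=> /H1; rewrite -f_next.
rewrite startS; split.
  split=> [/rcons_inj[E E']|bu].
    by apply/(HL u (inL E)).1; rewrite -(key E).
  have E : start (walk_path u) (size s) = s.
    apply/H1; case/andP: bu => bu ub; rewrite (le_trans Lb bu) f_next.
    exact: lt_le_trans ub bS.
  by rewrite E; congr rcons; have := (HL u (inL E)).1.2 bu; rewrite -(key E).
move=> /rcons_inj[E E']; rewrite (key E); apply: (HL u (inL E)).2.
by rewrite -(key E).
Qed.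

Definition clip (u : R) : R := if 0 <= u < 1 then u else 0.

Definition random_path (u : R) : Omega := walk_path (clip u).

(** The preimage of a cylinder is a half-open interval of the prescribed
    length, up to parameters outside [0 <= u < 1], which are all sent to one
    path. *)
Lemma random_path_cylinder s : exists (L : R) (C : set R),
  [/\ measurable C, C `&` `[0%R, 1%R[%classic = set0,
   path padj proot s -> 0 <= L /\ L + f (last proot s) <= 1 &
   random_path @^-1` cylinder s =
     (if path padj proot s then `[L, L + f (last proot s)[%classic
      else set0) `|` C].
Proof.
have [ps|ps] := boolP (path padj proot s); last first.
  exists 0, set0; split => //; first exact: set0I.
  by rewrite set0U; apply/seteqP; split=> // u /cylinder_path;
    rewrite (negbTE ps).
have [L [L0 L1 H]] := walk_cylinder ps.
(* Every parameter outside [0 <= u < 1] has the same path as -1. *)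
exists L, (~` `[0%R, 1%R[%classic `&`
  (if `[< cylinder s (random_path (-1)) >] then setT else set0)).
split=> //.
- by apply: measurableI; [exact: measurableC|case: ifP].
- by rewrite setIAC setICl set0I.
have itvE u : `[0%R, 1%R[%classic u -> random_path u = walk_path u.
  by rewrite /= in_itv/= => u01; rewrite /random_path /clip u01.
have outE u : ~ `[0%R, 1%R[%classic u -> random_path u = random_path (-1).
  rewrite /= in_itv/= => /negP/negbTE u01; rewrite /random_path /clip u01.
  by rewrite ifF// lerNr oppr0 ler10.
have sub u : L <= u < L + f (last proot s) -> `[0%R, 1%R[%classic u.
  move=> /andP[Lu uL]; rewrite /= in_itv/= (le_trans L0 Lu)/=.
  exact: lt_le_trans uL L1.
apply/seteqP; split=> u /=.
  have [u01|u01] := pselect (`[0%R, 1%R[%classic u).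
    rewrite itvE// => /((H u _).1.1); rewrite /= in_itv/= => Hu; left;
      apply: Hu.
    by move: u01; rewrite /= in_itv.
  by rewrite outE// => su; right; split=> //; case: asboolP.
case=> [|[u01]]; last by rewrite outE//; case: asboolP.
rewrite in_itv/= => Lu; have u01 := sub _ Lu; rewrite itvE//.
by apply/(H u _).1; [move: u01; rewrite /= in_itv|].
Qed.

Lemma measurable_random_path :
  @measurable_fun (R.-ocitv.-measurable).-sigma _ (measurableTypeR R) Omega
    setT random_path.
Proof.
apply: (@measurability _ _ _ Omega setT random_path cylinders
  measurable_cylinders).
move=> _ [_ [->|[s ->]] <-]; rewrite setTI; first by rewrite preimage_set0.
have [L [C [mC _ _ ->]]] := random_path_cylinder s.
by apply: measurableU => //; case: ifP.
Qed.

(** The image of the uniform measure of the unit interval under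
    [random_path]. *)
Lemma realization : exists nu : probability Omega R,
  forall s, path padj proot s -> nu (cylinder s) = (pfun phi (last proot s))%:E.
Proof.
pose P : probability (measurableTypeR R) R := uniform_prob (@ltr01 R).
pose X : {mfun measurableTypeR R >-> Omega} :=
  @mfun_Sub (R.-ocitv.-measurable).-sigma _ (measurableTypeR R) Omega _
    (mem_set measurable_random_path).
exists (distribution P X) => s ps.
have [L [C [mC C0 /(_ ps)[L0 L1] E]]] := random_path_cylinder s.
rewrite /distribution /pushforward /= -/(random_path @^-1` cylinder s) E ps.
rewrite /uniform_prob integral_uniform_pdf.
set I := `[L, _[%classic.
have subI : I `<=` `[0%R, 1%R]%classic.
  move=> u; rewrite /I /= !in_itv/= => /andP[Lu uL].
  by rewrite (le_trans L0 Lu) ltW// (lt_le_trans uL).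
have mI : measurable I by exact: measurable_itv.
have -> : (I `|` C) `&` `[0%R, 1%R]%classic = I `|` (C `&` `[0%R, 1%R]%classic).
  by rewrite setIUl; congr (_ `|` _); exact: setIidl.
have mC1 : measurable (C `&` `[0%R, 1%R]%classic) by exact: measurableI.
(* On [0 <= u <= 1], which carries the measure, [C] has at most the point 1. *)
have C1 : C `&` `[0%R, 1%R]%classic `<=` [set 1%R].
  move=> u [Cu]; rewrite /= in_itv/= => /andP[u0 u1].
  apply/eqP; rewrite eq_le u1 leNgt; apply/negP => u1'.
  suff : (C `&` `[0%R, 1%R[%classic) u by rewrite C0.
  by split=> //; rewrite /= in_itv/= u0 u1'.
rewrite (eq_integral (fun=> 1%E)); last first.
  move=> u; rewrite inE => -[/subI|[_]]; rewrite /= in_itv/= => u01;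
  by rewrite /uniform_pdf u01 subr0 invr1.
rewrite integral_cst ?mul1e//; last exact: measurableU.
rewrite measureU0//; last first.
  apply/eqP; rewrite eq_le measure_ge0 andbT -(lebesgue_measure_set1 (1 : R)).
  by apply: le_measure; rewrite ?inE//; exact: measurable_set1.
rewrite [LHS](lebesgue_measure_itv `[L, L + f (last proot s)[)/= lte_fin ltrDl.
case: ifPn => [_|]; first by rewrite -EFinB addrAC subrr add0r.
by rewrite -leNgt => fle; congr _%:E; apply/eqP; rewrite eq_le f_ge0.
Qed.

End realization.

(** * Ergodic central measures *)

Section ergodic.
Context {R : realType}.
Local Open Scope ereal_scope.

Definition saturation (A : set Omega) : set Omega :=
  [set w | exists w' : Omega, tail_equiv w w' /\ A w'].

Definition exchange_preimage (A : set Omega) (p : seq PFT * seq PFT) :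
    set Omega :=
  if `[< exchangeable p.1 p.2 >] then cylinder p.1 `&` replace p.2 @^-1` A
  else set0.

Lemma saturationE A : saturation A = \bigcup_p exchange_preimage A p.
Proof.
apply/seteqP; split=> w.
  move=> [w' [/tail_equiv_exchange[s [s' [ss' ws <-]]] Aw']].
  by exists (s, s') => //=; rewrite /exchange_preimage; case: asboolP.
move=> [[s s'] _ /=]; rewrite /exchange_preimage;
  case: asboolP => // ss' [ws Aw].
exists (replace s' w); split=> //.
exact/tail_equiv_sym/tail_equiv_replace.
Qed.

Lemma saturation_invariant A : tail_invariant (saturation A).
Proof.
move=> w w' ww' [u [wu Au]]; exists u; split=> //.
exact: tail_equiv_trans (tail_equiv_sym ww') wu.
Qed.

Lemma sub_saturation A : A `<=` saturation A.
Proof.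
by move=> w Aw; exists w; split=> //; apply/tail_equivP; exists 0%N.
Qed.

Lemma measurable_exchange_preimage A p :
  measurable A -> measurable (exchange_preimage A p).
Proof.
move=> mA; rewrite /exchange_preimage; case: ifP => // _; apply: measurableI;
  first exact: measurable_cylinder.
by rewrite -[X in measurable X]setTI; exact: measurable_replace.
Qed.

Lemma measurable_saturation A : measurable A -> measurable (saturation A).
Proof.
move=> mA; rewrite saturationE; apply: countable_bigcupT_measurable => // p.
exact: measurable_exchange_preimage.
Qed.

Lemma le_probability_eq (mu nu : probability Omega R) :
  (forall A, measurable A -> mu A <= nu A) -> forall A, measurable A ->
    mu A = nu A.
Proof.
move=> H A mA; apply/eqP; rewrite eq_le H//=.
have := H _ (measurableC mA); rewrite !probability_setC//.
rewrite -[mu A]fineK ?fin_num_measure// -[nu A]fineK ?fin_num_measure//.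
by rewrite -!EFinB !lee_fin; lra.
Qed.

(** A set on which [nu] is below [mu] keeps this property when a beginning is
    exchanged, both measures being invariant, and when countably many such sets
    are united. *)
Lemma negative_saturation (mu nu : probability Omega R) (N : set Omega) :
  central_measure mu -> central_measure nu -> measurable N ->
  (forall A, measurable A -> A `<=` N -> nu A <= mu A) ->
  forall A, measurable A -> A `<=` saturation N -> nu A <= mu A.
Proof.
move=> cmu cnu mN NN.
pose sigma : {charge set Omega -> \bar R} :=
  cadd (charge_of_finite_measure nu) (copp (charge_of_finite_measure mu)).
have sE A : sigma A = nu A - mu A by [].
have sN A : measurable A -> (sigma A <= 0) = (nu A <= mu A).
  by move=> mA; rewrite sE sube_le0 // fin_num_measure.
suff [_ H] : negative_set sigma (saturation N).
  by move=> A mA AN; rewrite -sN//; exact: H.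
rewrite saturationE.
rewrite (_ : \bigcup_p _ = \bigcup_i
   (if unpickle i is Some p then exchange_preimage N p else set0)); last first.
  apply/seteqP; split=> w [].
    by move=> p _ wp; exists (pickle p) => //; rewrite pickleK.
  by move=> i _; case: unpickle => // p wp; exists p.
apply: bigcup_negative_set => i; case: unpickle => [p|];
  last exact: negative_set0.
split; first exact: measurable_exchange_preimage.
case: p => s s' A mA; rewrite /exchange_preimage /=; case: asboolP => [ss'|_];
  last first.
  by rewrite subset0 => ->; rewrite charge0.
move=> AN; rewrite sN//.
have As : A = cylinder s `&` A.
  apply/seteqP; split=> w; last by case.
  by move=> Aw; split=> //; have [] := AN _ Aw.
have sy := exchangeable_sym ss'.
rewrite As -(exchange_invariance (probability_fin nu) cnu sy)//.
rewrite -(exchange_invariance (probability_fin mu) cmu sy)//.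
apply: NN.
  apply: measurableI; first exact: measurable_cylinder.
  by rewrite -[X in measurable X]setTI; exact: measurable_replace.
move=> w [ws' /AN[_ /=]].
by rewrite (replaceK sy ws').
Qed.

(** The saturation of the negative part of a Hahn decomposition of [nu - mu] is
    still negative, its complement is still positive, and it is tail invariant,
    so that one of the two is null for [nu] and then for [mu]. Hence one of the
    two probabilities is below the other one. *)
Lemma ergodic_unique (mu nu : probability Omega R) :
  central_measure nu -> ergodic nu -> central_measure mu ->
  (forall A, measurable A -> nu A = 0 -> mu A = 0) ->
  forall A, measurable A -> mu A = nu A.
Proof.
move=> cnu enu cmu ac.
pose sigma : {charge set Omega -> \bar R} :=
  cadd (charge_of_finite_measure nu) (copp (charge_of_finite_measure mu)).
have sE A : sigma A = nu A - mu A by [].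
have [P [N [[mP HP] [mN HN] PN _]]] := Hahn_decomposition sigma.
have sat : forall A, measurable A -> A `<=` saturation N -> nu A <= mu A.
  apply: negative_saturation => // A mA AN.
  by have := HN A mA AN; rewrite sE sube_le0 // fin_num_measure.
have cosat A : measurable A -> A `<=` ~` saturation N -> mu A <= nu A.
  move=> mA AN; have := HP A mA; rewrite sE sube_ge0 ?fin_num_measure//.
  apply=> w Aw; have : (P `|` N) w by rewrite PN.
  by case=> // /sub_saturation /(AN _ Aw).
have mS := measurable_saturation mN.
have split_ (m : probability Omega R) A : measurable A ->
    m A = m (A `&` saturation N) + m (A `\` saturation N).
  by move=> mA; rewrite addeC -measureDI.
have eqC : (forall A, measurable A -> mu A <= nu A) \/
    (forall A, measurable A -> nu A <= mu A).
  have [S0|S1] := enu _ mS (@saturation_invariant N); [left|right] => A mA.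
    have nuz (m : probability Omega R) : m (saturation N) = 0 ->
      m (A `&` saturation N) = 0.
      by move=> m0; apply: (subset_measure0 _ _ _ m0) => //; exact: measurableI.
    rewrite !(split_ _ A mA) (nuz mu) ?(nuz nu) ?add0e//; last exact: ac.
    by apply: cosat; [exact: measurableD|move=> w []].
  have C0 : nu (~` saturation N) = 0 by rewrite probability_setC// S1 subee.
  have nuz (m : probability Omega R) : m (~` saturation N) = 0 ->
    m (A `\` saturation N) = 0.
    move=> m0; apply: (subset_measure0 _ _ _ m0) => //;
      first exact: measurableD.
    exact: measurableC.
  rewrite !(split_ _ A mA) (nuz mu) ?(nuz nu) ?adde0//; last first.
    by apply: ac => //; exact: measurableC.
  by apply: sat; [exact: measurableI|move=> w []].
by move=> A mA; case: eqC => /le_probability_eq ->.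
Qed.

(** A harmonic function [psi] below that of [nu] splits [nu] as a mixture of
    two central probabilities; each is absolutely continuous with respect to
    [nu]. *)
Lemma ergodic_extremal (nu : probability Omega R) :
  central_measure nu -> ergodic nu -> extremal (cyl_fun nu).
Proof.
move=> cnu enu psi harm dom.
have fin := probability_fin nu.
have pharm := harmonic_cyl_fun fin cnu.
have pr : cyl_fun nu 0%N ft_root = 1%R.
  by apply: EFin_inj; rewrite (cyl_fun_root fin cnu); exact: probability_setT.
have psi0 : nonneg psi by move=> k v; have /andP[] := dom k v.
have rest0 : nonneg (fun k v => cyl_fun nu k v - psi k v)%R.
  by move=> k v; have /andP[_] := dom k v; rewrite subr_ge0.
have rharm := harmonicB pharm harm.
set c := psi 0%N ft_root.
have [c0 c1] : (0 <= c)%R /\ (c <= 1)%R by have /andP[] := dom 0%N ft_root;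
  rewrite pr.
move=> k v; move: c0; rewrite le_eqVlt => /orP[/eqP c0|c0].
  by rewrite -c0 mul0r (harmonic_eq0 harm).
move: c1; rewrite le_eqVlt => /orP[/eqP c1|c1].
  have := harmonic_eq0 rharm rest0 _ k v; rewrite pr -/c c1 subrr mul1r.
  by move=> /(_ erefl)/eqP; rewrite subr_eq0 => /eqP.
have c1' : (0 < 1 - c)%R by rewrite subr_gt0.
have [|||mu muE] := @realization R (fun k v => c^-1 * psi k v)%R.
- exact: harmonicZ.
- by move=> i u; rewrite mulr_ge0// invr_ge0 ltW.
- by rewrite -/c mulVf// gt_eqF.
have [|||mu' muE'] := @realization R (fun k v =>
  (1 - c)^-1 * (cyl_fun nu k v - psi k v))%R.
- exact: harmonicZ.
- by move=> i u; rewrite mulr_ge0// invr_ge0 ltW.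
- by rewrite pr -/c mulVf// gt_eqF.
pose mix : {measure set Omega -> \bar R} :=
  measure_add (mscale (NngNum (ltW c0)) mu) (mscale (NngNum (ltW c1')) mu').
have mixE A : mix A = c%:E * mu A + (1 - c)%:E * mu' A by exact: measure_addE.
have nuE : forall A, measurable A -> nu A = mix A.
  apply: cylinder_unique => // s ps;
    rewrite mixE muE// muE'// (cyl_funE fin cnu ps) /pfun.
  rewrite -!EFinM -EFinD !mulrA !mulfV ?gt_eqF//; congr _%:E; ring.
have muC : central_measure mu by exact: pfun_central muE.
have ac A : measurable A -> nu A = 0 -> mu A = 0.
  have ge0 (a : R) (m : probability Omega R) : (0 < a)%R -> 0 <= a%:E * m A.
    by move=> a0; rewrite mule_ge0 ?lee_fin ?measure_ge0// ltW.
  move=> mA; rewrite nuE// mixE => /eqP; rewrite padde_eq0 ?ge0//.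
  by rewrite mule_eq0 eqe gt_eqF//= => /andP[/eqP].
have [s ps sE] := path_to (pv k v).
have := ergodic_unique cnu enu muC ac (measurable_cylinder s).
rewrite muE// (cyl_funE fin cnu ps) sE !pfun_pv => -[<-].
by rewrite mulrA mulfV ?mul1r// gt_eqF.
Qed.

(** The restriction of [nu] to a tail invariant set [A] is central and below
    [nu], so by extremality it is [nu A] times [nu]; evaluated at [A], this
    gives [nu A = nu A ^ 2]. *)
Lemma extremal_ergodic (nu : probability Omega R) :
  central_measure nu -> extremal (cyl_fun nu) -> ergodic nu.
Proof.
move=> cnu ext A mA invA.
have fin := probability_fin nu.
pose m : {measure set Omega -> \bar R} := mrestr nu mA.
have mE B : m B = nu (B `&` A) by [].
have mfin : m setT < +oo by rewrite mE setTI ltey_eq fin_num_measure.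
have cm : central_measure m.
  move=> s s' ps ps' ss'; have ex : exchangeable s s' by split.
  rewrite !mE -(exchange_invariance fin cnu ex mA).
  congr (nu _); apply/seteqP; split=> w [ws Aw]; split=> //=.
    exact: invA (tail_equiv_sym (tail_equiv_replace _ _)) Aw.
  exact: invA (tail_equiv_replace _ _) Aw.
have dom k v : (0 <= cyl_fun m k v <= cyl_fun nu k v)%R.
  rewrite cyl_fun_ge0 /cyl_fun fine_le ?cyl_fin_num//= mE.
  apply: le_measure; rewrite ?inE; [|exact: measurable_cylinder|by move=> w []].
  by apply: measurableI => //; exact: measurable_cylinder.
have H := ext _ (harmonic_cyl_fun mfin cm) dom.
have nuA0 : (0 <= fine (nu A))%R by rewrite fine_ge0.
have rootE : cyl_fun m 0%N ft_root = fine (nu A).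
  by apply: EFin_inj; rewrite cyl_fun_root// mE setTI fineK ?fin_num_measure.
have : forall B, measurable B -> m B = mscale (NngNum nuA0) nu B.
  apply: cylinder_unique => // s ps.
  rewrite (cyl_funE mfin cm ps) [RHS](_ : _ = (fine (nu A))%:E * nu (cylinder
    s))//.
  by rewrite (cyl_funE fin cnu ps) -EFinM /pfun H rootE.
move=> /(_ A mA); rewrite mE setIid /mscale/= -[nu A]fineK ?fin_num_measure//.
rewrite -EFinM => -[/eqP]; rewrite eq_sym -subr_eq0 -[X in (_ - X)%R]mulr1
  -mulrBr mulf_eq0.
by rewrite subr_eq0 => /orP[/eqP ->|/eqP ->]; [left|right].
Qed.

End ergodic.

(** * The random walks with a prescribed end *)

Section esum_seq.
Context {R : realType}.

Lemma esum_seq (T : choiceType) (F : T -> R) (r : seq T) : uniq r ->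
  (forall x, 0 <= F x) -> (forall x, x \notin r -> F x = 0) ->
  (\esum_(x in [set: T]) (F x)%:E = (\sum_(x <- r) F x)%:E)%E.
Proof.
move=> ur F0 Fr.
rewrite [LHS](_ : _ = (\esum_(x in [set` r]) (F x)%:E)%E); last first.
  rewrite [RHS]esum_mkcond; apply: eq_esum => x _.
  by case: ifPn => //; rewrite notin_setE /= => /negP/Fr ->.
rewrite esum_fset//; last by move=> x _; rewrite lee_fin.
by rewrite -fsbig_seq// sumEFin.
Qed.

End esum_seq.

Section geodesics.
Implicit Types (t : FTend) (v w : FT).

Lemma edge_on_child t v c : c \in children v -> on_ray t c -> edge_on t v c.
Proof.
move=> cv ct; exists (ft_depth v); left; split.
  by apply/eqP; exact: on_ray_parent cv ct.
by move/eqP : ct; rewrite (ft_depth_child cv).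
Qed.

Lemma edge_on_sym t v w : edge_on t v w -> edge_on t w v.
Proof. by move=> [i [[-> ->]|[-> ->]]]; exists i; [right|left]. Qed.

Lemma edge_on_childE t v c : c \in children v -> edge_on t v c -> on_ray t c.
Proof.
move=> cv [i [[_ ->]|[vE cE]]]; first exact: on_ray_end.
by rewrite cE on_ray_end.
Qed.

Lemma t_directed_parent t v c : c \in children v -> ~~ on_ray t c ->
  t_directed t c v.
Proof.
move=> cv ct; split; first by rewrite /ft_adj !is_childP cv orbT.
by exists 1%N; rewrite /geodesic_ray /= /ray_next -/(on_ray t c) (negbTE ct)
  (parent_children cv).
Qed.

(** The geodesic ray from [v] stays at depth at most that of [v] until it meets
    [t]. *)
Lemma t_directed_child t v c : c \in children v -> ~~ on_ray t c ->
  ~ t_directed t v c.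
Proof.
move=> cv ct [_ [k kc]].
have : on_ray t (geodesic_ray t v k) ||
    (ft_depth (geodesic_ray t v k) <= ft_depth v)%N.
  elim: k {kc} => [|k]; first by rewrite leqnn orbT.
  rewrite /geodesic_ray iterS -/(geodesic_ray t v k);
    move: (geodesic_ray _ _ _) => u.
  rewrite /ray_next -/(on_ray t u); case: ifPn => [_ _|ut /= uv].
    by rewrite on_ray_end.
  rewrite (leq_trans _ uv) ?orbT//.
  have [->//|u0] := eqVneq u ft_root.
  by rewrite [leqRHS]ft_depth_parent// leqnSn.
by rewrite kc (negbTE ct) (ft_depth_child cv) ltnn.
Qed.

Lemma ft_adj_child v c : c \in children v -> ft_adj v c /\ ft_adj c v.
Proof. by move=> cv; rewrite /ft_adj !is_childP cv orbT. Qed.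

Definition neighbours v : seq FT :=
  children v ++ (if v == ft_root then [::] else [:: ft_parent v]).

Lemma child_neq_parent v c : c \in children v -> c <> ft_parent v.
Proof.
move=> cv cp; have := ft_depth_child cv; rewrite cp.
have [->|v0] := eqVneq v ft_root; first by [].
by have := ft_depth_parent v0; lia.
Qed.

Lemma uniq_neighbours v : uniq (neighbours v).
Proof.
rewrite /neighbours cat_uniq uniq_children; case: ifP => //= _.
by rewrite orbF andbT; apply/negP => /child_neq_parent.
Qed.

Lemma ft_adjE v w : ft_adj v w = (w \in neighbours v).
Proof.
rewrite /ft_adj is_childP /neighbours mem_cat /is_child.
by case: eqP => //= _; rewrite inE eq_sym.
Qed.

End geodesics.

Section S_kernel.
Context {R : realType}.
Variables (t : FTend) (eta : R).
Hypothesis eta01 : 0 <= eta <= 4 / 27.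
Let eta0 : 0 <= eta. Proof. by case/andP: eta01. Qed.
Let eta1 : eta <= 4 / 27. Proof. by case/andP: eta01. Qed.
Let G := gen_G eta.
Let Gp : 0 < G. Proof. exact: gen_G_gt0. Qed.

(** The probability of the step from [t i] to [t i.+1], dictated by the
    condition on the products along edges and by the total mass one at
    [t i]. *)
Fixpoint ray_prob (i : nat) : R :=
  if i is j.+1 then 1 - eta / ray_prob j -
    \sum_(c <- children (t i) | c != t i.+1) eta * G ^+ ft_label c
  else 1.

Let F_ge0 c : 0 <= eta * G ^+ ft_label c.
Proof. by rewrite mulr_ge0// exprn_ge0// ltW. Qed.

Let sum_ray i : eta * G ^+ ft_label (t i.+1) +
  \sum_(c <- children (t i) | c != t i.+1) eta * G ^+ ft_label c
  = 1 - G ^- ft_label (t i).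
Proof.
rewrite -(sum_children_gen_G eta0 eta1) [RHS](bigD1_seq (t i.+1))
  ?uniq_children//.
exact: end_children.
Qed.

(** The bound says that stepping back along [t] is at most as likely as the
    step towards [t] from a vertex of the same label off [t]; this leaves room
    for a nonnegative probability of going forward. *)
Lemma ray_prob_gt0 i :
  eta * G ^+ ft_label (t i.+1) <= ray_prob i /\ 0 < ray_prob i.
Proof.
have sg j : 0 <= \sum_(c <- children (t j) | c != t j.+1) eta * G ^+ ft_label c.
  by apply: sumr_ge0 => c _; exact: F_ge0.
elim: i => [|i [IH1 IH2]] /=.
  split; last exact: ltr01.
  have := sum_ray 0; have := sg 0%N.
  have : 0 <= G ^- ft_label (t 0%N) by rewrite invr_ge0 exprn_ge0// ltW.
  lra.
have le1 : eta / ray_prob i <= G ^- ft_label (t i.+1).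
  by rewrite ler_pdivrMr// mulrC ler_pdivlMr// exprn_gt0.
have bnd := sum_ray i.+1; split; first by move: le1 bnd => /=; lra.
have [e0|e0] := eqVneq eta 0.
  rewrite e0 mul0r subr0 big1 ?subr0// => c _; by rewrite mul0r.
have ep : 0 < eta by rewrite lt_neqAle eq_sym e0.
have : 0 < eta * G ^+ ft_label (t i.+2) by rewrite mulr_gt0// exprn_gt0.
move: le1 bnd => /=; lra.
Qed.

Definition down_prob (w : FT) : R :=
  if on_ray t w then ray_prob (ft_depth w).-1 else eta * G ^+ ft_label w.

Definition up_prob (v : FT) : R :=
  if on_ray t v then eta / ray_prob (ft_depth v).-1 else G ^- ft_label v.

Definition ray_kernel (v w : FT) : R :=
  if is_child w v then down_prob w else if is_child v w then up_prob v else 0.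

Lemma kernel_child v c : c \in children v -> ray_kernel v c = down_prob c.
Proof. by rewrite /ray_kernel is_childP => ->. Qed.

Lemma kernel_parent v c : c \in children v -> ray_kernel c v = up_prob c.
Proof.
move=> cv; rewrite /ray_kernel !is_childP cv ifN//.
by apply/negP => /child_neq_parent; rewrite (parent_children cv).
Qed.

Lemma down_up w : down_prob w * up_prob w = eta.
Proof.
rewrite /down_prob /up_prob; case: ifP => _.
  by rewrite mulrCA mulfV ?mulr1// gt_eqF//;
    have [] := ray_prob_gt0 (ft_depth w).-1.
by rewrite -mulrA mulfV ?mulr1// expf_neq0// gt_eqF.
Qed.

Lemma kernel_ge0 v w : 0 <= ray_kernel v w.
Proof.
have rp i : 0 <= ray_prob i by apply: ltW; have [] := ray_prob_gt0 i.
rewrite /ray_kernel /down_prob /up_prob; case: ifP => _; first by case: ifP.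
case: ifP => // _; case: ifP => _; first by rewrite divr_ge0.
by rewrite invr_ge0 exprn_ge0// ltW.
Qed.

Lemma kernel_sum v : \sum_(w <- neighbours v) ray_kernel v w = 1.
Proof.
rewrite /neighbours big_cat.
rewrite (eq_big_seq down_prob)/=; last by move=> c /kernel_child.
have [vt|vt] := boolP (on_ray t v); last first.
  have v0 : v != ft_root.
    by apply: contraNneq vt => ->; rewrite /on_ray end_ray0.
  rewrite (negbTE v0) big_seq1 (kernel_parent (children_parent v0)) /up_prob
    (negbTE vt).
  rewrite (eq_big_seq (fun c => eta * G ^+ ft_label c)).
    by rewrite (sum_children_gen_G eta0 eta1) subrK.
  move=> c cv; rewrite /down_prob ifN//; apply: contra vt; exact: on_ray_parent.
move: vt; rewrite /on_ray => /eqP; move: (ft_depth v) => i -> {v}.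
rewrite (bigD1_seq (t i.+1)) ?uniq_children ?end_children//=.
rewrite {1}/down_prob on_ray_end ft_depth_end /=.
rewrite big_seq_cond (eq_bigr (fun c => eta * G ^+ ft_label c)); last first.
  move=> c /andP[ct cN]; rewrite /down_prob ifN//.
  by rewrite (on_ray_children ct).
rewrite -big_seq_cond.
case: i => [|i].
  have := end_children t 0; rewrite end_ray0 eqxx big_nil addr0 => t1.
  rewrite big_seq_cond big1 ?addr0// => c /andP[].
  move: t1; rewrite /children /= !inE => /eqP -> /eqP ->.
  by rewrite eqxx.
have v0 := children_neq_root (end_children t i).
rewrite (negbTE v0) big_seq1 (kernel_parent (children_parent v0)) /up_prob
  on_ray_end.
rewrite ft_depth_end /=; ring.
Qed.

Lemma is_S_kernel_exists : is_S_kernel t eta ray_kernel.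
Proof.
split; first split.
- exact: kernel_ge0.
- move=> v w; rewrite /ft_adj negb_or /ray_kernel =>
  /andP[/negbTE -> /negbTE ->] //.
- move=> v; rewrite (esum_seq (uniq_neighbours v)) ?kernel_sum//.
    exact: kernel_ge0.
  move=> w; rewrite -ft_adjE /ft_adj negb_or /ray_kernel.
  by move=> /andP[/negbTE -> /negbTE ->].
have ca : vertex_a \in children ft_root by rewrite -is_childP.
have at_ : on_ray t vertex_a.
  rewrite /on_ray; have := end_children t 0;
    rewrite end_ray0 /children /= inE => /eqP ->.
  exact/eqP/val_inj.
split.
- rewrite (kernel_child ca) (kernel_parent ca) /down_prob /up_prob at_ /=.
  by rewrite divr1.
- move=> v w; rewrite ft_adjE /neighbours mem_cat => vw on.
  have {vw} [wv|vw] : w \in children v \/ v \in children w.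
    case/orP: vw; first by left.
    case: ifPn => // v0; rewrite inE => /eqP ->; right; exact: children_parent.
    have wt : ~~ on_ray t w by apply/negP => wt; apply: on;
      exact: edge_on_child.
    split=> [/(t_directed_child wv wt)//|_].
    by rewrite (kernel_child wv) /down_prob (negbTE wt).
  have vt : ~~ on_ray t v.
    by apply/negP => vt; apply/on/edge_on_sym; exact: edge_on_child.
  split=> [_|[]]; last exact: t_directed_parent.
  by rewrite (kernel_parent vw) /up_prob (negbTE vt).
- move=> v w; rewrite ft_adjE /neighbours mem_cat => vw.
  have {vw} [wv|vw] : w \in children v \/ v \in children w.
    case/orP: vw; first by left.
    case: ifPn => // v0; rewrite inE => /eqP ->; right; exact: children_parent.
    by rewrite (kernel_child wv) (kernel_parent wv) down_up.
  by rewrite (kernel_child vw) (kernel_parent vw) mulrC down_up.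
Qed.

Lemma S_kernelP : is_S_kernel t eta (S_kernel t eta).
Proof.
apply: (@getPex _ [set p | is_S_kernel t eta p]).
by exists ray_kernel; exact: is_S_kernel_exists.
Qed.

Let p : FT -> FT -> R := S_kernel t eta.

Let p_ge0 v w : 0 <= p v w.
Proof. by have [[]] := S_kernelP. Qed.

Let p_sum v : \sum_(w <- neighbours v) p v w = 1.
Proof.
have [[p0 padj psum] _] := S_kernelP; apply: EFin_inj; rewrite -(psum v).
rewrite -(esum_seq (uniq_neighbours v)) => // w; rewrite -ft_adjE; exact: padj.
Qed.

Let p_product v c : c \in children v -> p v c * p c v = eta.
Proof. by have [_ [_ _ H]] := S_kernelP => /ft_adj_child[vc _]; exact: H. Qed.

Let p_off v c : c \in children v -> ~~ on_ray t c ->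
  p v c = eta * G ^+ ft_label c.
Proof.
have [_ [_ H _]] := S_kernelP => cv ct; have [vc _] := ft_adj_child cv.
apply: (H v c vc _).2; last exact: t_directed_child.
by move/(edge_on_childE cv); rewrite (negbTE ct).
Qed.

Fixpoint geodesic_word (s : seq nat) : R :=
  if s is _ :: s' then
    geodesic_word s' * p (insubd ft_root s') (insubd ft_root s)
  else 1.

(** The probability that the walk goes straight from the root to [v]. *)
Definition geodesic_prob (v : FT) : R := geodesic_word (word v).

Lemma geodesic_prob_child v c : c \in children v ->
  geodesic_prob c = geodesic_prob v * p v c.
Proof.
move=> cv; rewrite /geodesic_prob (word_children cv) /=.
by rewrite -(word_children cv) -[word c]/(val c) -[word v]/(val v) !valKd.
Qed.

Lemma geodesic_prob_ge0 v : 0 <= geodesic_prob v.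
Proof.
elim/FT_ind: v => [|v c cv IHv]; first exact: ler01.
by rewrite (geodesic_prob_child cv) mulr_ge0.
Qed.

Lemma geodesic_prob_up v c : c \in children v ->
  geodesic_prob c * p c v = eta * geodesic_prob v.
Proof. by move=> cv; rewrite (geodesic_prob_child cv) -mulrA (p_product cv)
  mulrC. Qed.

Lemma eigen_geodesic_prob : eigen eta geodesic_prob.
Proof.
move=> v; rewrite -[LHS]mulr1 -(p_sum v) /neighbours big_cat mulrDr;
  congr (_ + _).
  rewrite mulr_sumr; apply: eq_big_seq => c cv.
  by rewrite (geodesic_prob_child cv).
rewrite /at_parent; case: ifPn => [_|v0]; first by rewrite big_nil !mulr0.
by rewrite big_seq1 (geodesic_prob_up (children_parent v0)).
Qed.

Lemma off_ray_geodesic_prob : off_ray eta t geodesic_prob.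
Proof. by move=> v c cv ct;
  rewrite (geodesic_prob_child cv) (p_off cv ct) mulrC. Qed.

(** A path to [pv k v] follows the geodesic to [v] but for [k] pairs of steps
    back and forth across an edge, each of which has probability [eta]. *)
Definition walk_fun (k : nat) (v : FT) : R := eta ^+ k * geodesic_prob v.

Lemma walk_fun_step x y : padj x y ->
  pfun walk_fun y = pfun walk_fun x * pascal_kernel p x y.
Proof.
move=> xy; rewrite /pascal_kernel; case/andP : (xy) => -> _.
move: xy; rewrite padjE /pnext mem_cat => /orP[/mapP[c cx ->]|].
  rewrite pfun_pv /pfun /walk_fun -mulrA; congr (_ * _).
  exact: geodesic_prob_child.
case: ifPn => // x0; rewrite inE => /eqP ->; rewrite pfun_pv /pfun /walk_fun.
rewrite -mulrA (geodesic_prob_up (children_parent x0)).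
by rewrite exprSr mulrA.
Qed.

Lemma zip_rcons_path (T : Type) (x y : T) s :
  zip (x :: rcons s y) (rcons s y) = rcons (zip (x :: s) s) (last x s, y).
Proof. by elim: s x => [//|z s IHs] x /=; rewrite -IHs. Qed.

Lemma walk_fun_path s : path padj proot s ->
  \prod_(xy <- zip (proot :: s) s) pascal_kernel p xy.1 xy.2 =
  pfun walk_fun (last proot s).
Proof.
elim/last_ind: s => [_|s y IHs].
  by rewrite /= big_nil proot_pv pfun_pv /walk_fun !mul1r.
rewrite rcons_path last_rcons => /andP[/IHs{IHs}E xy].
by rewrite zip_rcons_path -cats1 big_cat big_seq1 E (walk_fun_step xy).
Qed.

Lemma harmonic_walk_fun : harmonic walk_fun.
Proof. exact/eigen_harmonic/eigen_geodesic_prob. Qed.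

Lemma nu_walk_cylinder s : path padj proot s ->
  nu_walk t eta (cylinder s) = (pfun walk_fun (last proot s))%:E.
Proof.
move=> ps; rewrite -walk_fun_path//.
suff : markov_measure (pascal_kernel p) (nu_walk t eta) by apply.
apply: (@getPex _
  [set nu : probability Omega R | markov_measure (pascal_kernel p) nu]).
have [|||nu nuE] := @realization R walk_fun.
- exact: harmonic_walk_fun.
- by move=> k v; rewrite mulr_ge0 ?exprn_ge0 ?geodesic_prob_ge0.
- by rewrite /walk_fun !mul1r.
by exists nu => s' ps'; rewrite nuE// walk_fun_path.
Qed.

Lemma extremal_walk_fun : extremal walk_fun.
Proof.
apply: (off_ray_extremal eta01 eigen_geodesic_prob geodesic_prob_ge0 _
  off_ray_geodesic_prob).
by [].
Qed.

Lemma walk_fun_unique h : eigen eta h -> off_ray eta t h -> h ft_root = 1 ->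
  h =1 geodesic_prob.
Proof.
move=> H off hr.
exact: (off_ray_eigen_unique H eigen_geodesic_prob off off_ray_geodesic_prob).
Qed.

End S_kernel.

(** * Ergodic central measures and random walks *)

Theorem theoremA (R : realType) :
  [set nu : probability Omega R | central nu /\ ergodic nu] = @Sigma R.
Proof.
apply/seteqP; split=> nu.
  move=> [/central_measureP cnu enu].
  have fin := probability_fin nu.
  have root1 : cyl_fun nu 0%N ft_root = 1.
    by apply: EFin_inj; rewrite (cyl_fun_root fin cnu); exact: probability_setT.
  have [t [eta [h [eta01 eig off phiE]]]] := extremal_product
    (harmonic_cyl_fun fin cnu) (cyl_fun_ge0 nu) root1
    (ergodic_extremal cnu enu).
  exists t, eta; split=> //; apply: cylinder_unique => // s ps.
  rewrite (cyl_funE fin cnu ps) [RHS](nu_walk_cylinder t eta01 ps) /pfun phiE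
    /walk_fun.
  rewrite (walk_fun_unique eta01 eig off)//.
  by rewrite -root1 phiE mul1r.
move=> [t [eta [eta01 nuE]]].
have cylE s : path padj proot s ->
    nu (cylinder s) = (pfun (walk_fun t eta) (last proot s))%:E.
  by move=> ps; rewrite nuE ?nu_walk_cylinder//; exact: measurable_cylinder.
have cnu : central_measure nu by exact: pfun_central cylE.
split; first exact/central_measureP.
apply: extremal_ergodic => //.
have -> : cyl_fun nu = walk_fun t eta; last exact: extremal_walk_fun.
apply/funext => k; apply/funext => v; have [s ps sE] := path_to (pv k v).
apply: EFin_inj; rewrite -[in LHS](pfun_pv (cyl_fun nu)).
rewrite -[in RHS](pfun_pv (walk_fun _ _)).
by rewrite -sE -(cyl_funE (probability_fin nu) cnu ps); exact: cylE.
Qed.
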